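(* Assume that $\mathfrak g$ is of classical type ($A$, $B$, $C$ or $D$) or of type $G_2$. Let $\lambda\in P^+$ and $\ell\in\mathbb N$ be such that $\lambda(h_i)\le d_i\ell$ for all $1\le i\le n$. Then there exist $\mu\in L^+$ and $w\in W$ such that $$w\,t_\mu(\ell\Lambda_0+w_0\lambda)\in\hat P^+.$$
   Context: $\mathfrak g$ is a simple finite-dimensional complex Lie algebra of rank $n$ with Cartan subalgebra $\mathfrak h$, simple roots $\alpha_i$, simple coroots $h_i$ ($1\le i\le n$), fundamental weights $\omega_i$, Weyl group $W$ with longest element $w_0$, highest root $\theta$ with coroot $h_\theta$. $P^+$ is the $\mathbb Z_+$-span of the $\omega_i$; $\mathbb N$ is the set of positive integers. $d_i=1$ if $\alpha_i$ is long (all roots are long in the simply-laced case), $d_i=2$ if $\alpha_i$ is short and $\mathfrak g$ is not $G_2$, $d_i=3$ if $\alpha_i$ is short and $\mathfrak g$ is $G_2$. $L$ (resp. $L^+$) is the $\mathbb Z$-span (resp. $\mathbb Z_+$-span) of $d_i\omega_i$. $(\ ,\ )$ is the invariant form on $\mathfrak h^*$ normalized so that long roots have square length $2$. The dual of the affine Cartan subalgebra is $\hat{\mathfrak h}^*=\mathfrak h^*\oplus\mathbb C\Lambda_0\oplus\mathbb C\delta$. Put $\Lambda_i=\omega_i+\omega_i(h_\theta)\Lambda_0$ for $1\le i\le n$. $\hat P^+$ is the set of dominant integral affine weights, i.e. the $\mathbb Z_+$-span of the elements $\Lambda_i+\mathbb Z\delta$, $0\le i\le n$. $W$ acts on $\hat{\mathfrak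 h}^*$ by its usual action on $\mathfrak h^*$, fixing $\Lambda_0$ and $\delta$. For $\mu\in L$ the translation $t_\mu$ is the linear map on $\hat{\mathfrak h}^*$ given by $t_\mu(\lambda)=\lambda-(\lambda,\mu)\delta$ for $\lambda\in\mathfrak h^*\oplus\mathbb C\delta$ (with $(\delta,\mu)=0$), and $t_\mu(\Lambda_0)=\Lambda_0+\mu-\tfrac12(\mu,\mu)\delta$. *)

(* Defs.v *)
From HB Require Import structures.
From mathcomp Require Import all_boot all_order all_algebra all_fingroup.
From mathcomp Require Import reals complex.

Set Implicit Arguments.
Unset Strict Implicit.
Unset Printing Implicit Defensive.

Import Order.TTheory GRing.Theory Num.Theory.
Local Open Scope ring_scope.

(* The Z_+-span of S: finite sums, with repetitions, of elements of S. *)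
Definition nat_span (V : nmodType) (S : V -> Prop) (v : V) : Prop :=
  exists s : seq V, (forall x, x \in s -> S x) /\ v = \sum_(x <- s) x.

Section LieAlgebra.

Variables (F : fieldType) (g : vectType F) (br : g -> g -> g).
Implicit Types x y z : g.

Definition is_lie_bracket : Prop :=
  [/\ forall (c : F) x y z, br (c *: x + y) z = c *: br x z + br y z,
      forall (c : F) x y z, br z (c *: x + y) = c *: br z x + br z y,
      forall x, br x x = 0
    & forall x y z, br x (br y z) + br y (br z x) + br z (br x y) = 0].

Definition is_ideal (I : {vspace g}) : Prop :=
  forall x y, y \in I -> br x y \in I.

Definition is_simple : Prop :=
  (exists x y, br x y != 0) /\
  forall I : {vspace g}, is_ideal I -> I = 0%VS \/ I = fullv.

Definition is_abelian (a : {vspace g}) : Prop :=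
  forall x y, x \in a -> y \in a -> br x y = 0.

Definition is_diagonalizable (f : g -> g) : Prop :=
  exists2 b : seq g, basis_of fullv b &
    forall x, x \in b -> exists c : F, f x = c *: x.

(* For semisimple complex Lie algebras: a maximal abelian subalgebra that
   acts diagonalizably in the adjoint representation. *)
Definition is_cartan (h : {vspace g}) : Prop :=
  [/\ is_abelian h,
      forall a : {vspace g}, is_abelian a -> (h <= a)%VS -> a = h
    & forall x, x \in h -> is_diagonalizable (br x)].

End LieAlgebra.

Definition dual (F : fieldType) (g : vectType F) (h : {vspace g}) : vectType F :=
  'Hom(subvs_of h, F^o).

Section Roots.

Variables (F : numClosedFieldType) (g : vectType F) (br : g -> g -> g).
Variable h : {vspace g}.
Local Notation hdual := (dual h).

Definition root_space (beta : hdual) (x : g) : Prop :=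
  forall H : subvs_of h, br (vsval H) x = beta H *: x.

Definition is_root (beta : hdual) : Prop :=
  beta != 0 /\ exists2 x : g, x != 0 & root_space beta x.

(* Root spaces of a simple complex Lie algebra are lines, so a single bracket
   suffices to describe the elements of [g_beta, g_(-beta)]. *)
Definition is_coroot (beta : hdual) (H : subvs_of h) : Prop :=
  beta H = 2 /\
  exists x y : g, [/\ root_space beta x, root_space (- beta) y
                    & vsval H = br x y].

Variable n : nat.

Definition root_lattice_ge0 (alpha : 'I_n -> hdual) : hdual -> Prop :=
  nat_span (fun b => exists i, b = alpha i).

(* Since alpha is in particular a basis of the dual of h, n is the rank. *)
Definition is_simple_roots (alpha : 'I_n -> hdual) : Prop :=
  [/\ basis_of fullv [seq alpha i | i <- enum 'I_n],
      forall i, is_root (alpha i)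
    & forall beta, is_root beta ->
        root_lattice_ge0 alpha beta \/ root_lattice_ge0 alpha (- beta)].

Definition is_highest_root (alpha : 'I_n -> hdual) (theta : hdual) : Prop :=
  is_root theta /\
  forall beta, is_root beta -> root_lattice_ge0 alpha (theta - beta).

Definition is_fundamental_weights (hc : 'I_n -> subvs_of h)
    (omega : 'I_n -> hdual) : Prop :=
  forall i j, omega i (hc j) = (i == j)%:R.

Section Weyl.

Variables (alpha : 'I_n -> hdual) (hc : 'I_n -> subvs_of h).

Definition simple_reflection (i : 'I_n) (lam : hdual) : hdual :=
  lam - lam (hc i) *: alpha i.

Definition weyl_word (s : seq 'I_n) (lam : hdual) : hdual :=
  foldr simple_reflection lam s.

Definition in_weyl (w : hdual -> hdual) : Prop :=
  exists s, w =1 weyl_word s.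

Definition weyl_length (w : hdual -> hdual) (k : nat) : Prop :=
  (exists2 s, size s = k & w =1 weyl_word s) /\
  forall s, w =1 weyl_word s -> (k <= size s)%N.

Definition is_longest (w0 : hdual -> hdual) : Prop :=
  in_weyl w0 /\
  forall w k k0, weyl_length w k -> weyl_length w0 k0 -> (k <= k0)%N.

(* The order on F only compares numbers with a real difference, so the last two
   clauses say that the square lengths of the roots are real, with maximum 2. *)
Definition is_normalized_form (B : hdual -> hdual -> F) : Prop :=
  [/\ forall c x y z, B (c *: x + y) z = c * B x z + B y z,
      forall x y, B x y = B y x,
      forall w x y, in_weyl w -> B (w x) (w y) = B x y,
      exists2 beta, is_root beta & B beta beta = 2
    & forall beta, is_root beta -> B beta beta <= 2].

End Weyl.

End Roots.

Inductive lie_type := TypeA | TypeB | TypeC | TypeD | TypeG2.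

Definition rank_ok (X : lie_type) (n : nat) : bool :=
  match X with
  | TypeA => 1 <= n
  | TypeB | TypeC => 2 <= n
  | TypeD => 4 <= n
  | TypeG2 => n == 2
  end%N.

(* Bourbaki's labelling shifted to start at 0; entry (i, j) is alpha_j(h_i). *)
Definition cartan_entry (X : lie_type) (n i j : nat) : int :=
  if i == j then 2 else
  let adjacent := (j == i.+1) || (i == j.+1) in
  match X with
  | TypeA => if adjacent then -1 else 0
  | TypeB => if (i == n.-1) && (j == n.-2) then - 2%:Z
             else if adjacent then -1 else 0
  | TypeC => if (i == n.-2) && (j == n.-1) then - 2%:Z
             else if adjacent then -1 else 0
  | TypeD => if (adjacent && (i < n.-1) && (j < n.-1))%N
                || (i == n - 3)%N && (j == n.-1)
                || (j == n - 3)%N && (i == n.-1)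
             then -1 else 0
  | TypeG2 => if (i == 0)%N then - 3%:Z else -1
  end.

Section Affine.

Variables (F : numClosedFieldType) (g : vectType F) (h : {vspace g}).
Local Notation hdual := (dual h).
Variable n : nat.

(* The simple roots need not come in Bourbaki's order. *)
Definition has_type (X : lie_type) (alpha : 'I_n -> hdual)
    (hc : 'I_n -> subvs_of h) : Prop :=
  rank_ok X n /\
  exists s : {perm 'I_n},
    forall i j, alpha (s j) (hc (s i)) = (cartan_entry X n i j)%:~R.

(* With the normalized form B, long means of square length 2. *)
Definition dcoef (X : lie_type) (B : hdual -> hdual -> F)
    (alpha : 'I_n -> hdual) (i : 'I_n) : nat :=
  if B (alpha i) (alpha i) == 2 then 1%N
  else if X is TypeG2 then 3%N else 2%N.

Definition weight_ge0 (omega : 'I_n -> hdual) : hdual -> Prop :=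
  nat_span (fun x => exists i, x = omega i).

Definition L_ge0 (d : 'I_n -> nat) (omega : 'I_n -> hdual) : hdual -> Prop :=
  nat_span (fun x => exists i, x = omega i *+ d i).

(* (v, a, b) stands for v + a Lambda_0 + b delta. *)
Definition aff_dual : lmodType F := (hdual * F^o * F^o)%type.

Definition aff_emb (v : hdual) : aff_dual := (v, 0, 0).
Definition Lambda0 : aff_dual := (0, 1, 0).
Definition delta : aff_dual := (0, 0, 1).

Definition aff_weyl (w : hdual -> hdual) (x : aff_dual) : aff_dual :=
  let: (v, a, b) := x in aff_emb (w v) + a *: Lambda0 + b *: delta.

Definition translation (B : hdual -> hdual -> F) (mu : hdual)
    (x : aff_dual) : aff_dual :=
  let: (v, a, b) := x in
  (aff_emb v - B v mu *: delta)
  + a *: (Lambda0 + aff_emb mu - (2^-1 * B mu mu) *: delta)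
  + b *: delta.

Definition is_aff_fundamental (omega : 'I_n -> hdual) (htheta : subvs_of h)
    (x : aff_dual) : Prop :=
  x = Lambda0 \/
  exists i, x = aff_emb (omega i) + (omega i htheta : F) *: Lambda0.

Definition aff_weight_ge0 (omega : 'I_n -> hdual) (htheta : subvs_of h) :
    aff_dual -> Prop :=
  nat_span (fun x => exists (y : aff_dual) (k : int),
    is_aff_fundamental omega htheta y /\ x = y + k%:~R *: delta).

End Affine.

Arguments Lambda0 {F g h}.
Arguments delta {F g h}.

(* Main.v *)
Require Import Defs.
From HB Require Import structures.
From mathcomp Require Import all_boot all_order all_algebra all_fingroup.
From mathcomp Require Import reals complex.
From mathcomp Require Import boolp zify ring lra.

Set Implicit Arguments.
Unset Strict Implicit.
Unset Printing Implicit Defensive.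

Import Order.TTheory GRing.Theory Num.Theory.
Local Open Scope ring_scope.

(** Write [x = w0 lam], an antidominant weight, let [B] be the normalised form and
    let [M] be the lattice spanned by the coroots [2 alpha_i / B alpha_i alpha_i],
    transported to the dual of the Cartan subalgebra by [B].  These coroots are
    the [d_i alpha_i], and [M] is contained in the lattice [L].  The element
    [w t_mu (l Lambda_0 + x)] has finite part [w (x + l mu)] and level [l], so the
    problem is to bring [x] by a translation in [l M] and a Weyl group element
    into the dilated fundamental alcove: labels nonnegative and value at most [l]
    on the coroot of [theta].

    Choose [mu] in [M] minimising the norm of [x + l mu] and, among these minima,
    maximising the height of [mu], its pairing with the sum of the [omega_i].
    - Comparison with [mu + beta^vee] for [beta] simple shows that [mu] is
      dominant: if [B mu alpha_i <= -1], then, since the labels of [x] are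
      nonpositive, adding the coroot does not increase the norm, and it raises
      the height.
    - Comparison with [mu - w^(-1) theta], which lies in [M] because [theta] is
      long, shows that [B (w (x + l mu)) theta <= l] for every [w], in particular
      for the [w] that makes [x + l mu] dominant.
    - The coefficient of [delta] is an integer because [M] is an even lattice
      which pairs integrally with the weights.
    This is the content of [dominant_translate] and [translate_to_alcove], and
    the argument is uniform in the type.

    The ingredients are built from the definitions.  Elementary sl2 theory gives
    that reflections permute the roots ([reflect_root]), that the root system is
    reduced ([root_multiple]) and that there are finitely many roots
    ([root_string_finite]).  Hence every root is conjugate to a simple one
    ([root_conj_simple]), which gives the lengths of the simple roots from the
    Cartan matrix ([dcoef_sq]); the exchange property makes [w0 lam] antidominant
    ([longest_antidominant]).  A positive vector whose image under the Cartan
    matrix is positive ([cartan_pos_vec]) makes the form positive definite on the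
    root lattice, so that the minima exist ([lattice_minimum]). *)

(** * Representations of sl2 and root strings *)

Section LinearOperations.

Variables (F : fieldType) (U V : lmodType F) (T : U -> V).
Hypothesis T_lin : forall (c : F) x y, T (c *: x + y) = c *: T x + T y.

Lemma linear0_of : T 0 = 0.
Proof. by have := T_lin (-1) 0 0; rewrite scaler0 addr0 scaleN1r addNr. Qed.

Lemma linearZ_of c x : T (c *: x) = c *: T x.
Proof. by rewrite -[c *: x]addr0 T_lin linear0_of addr0. Qed.

Lemma linearD_of x y : T (x + y) = T x + T y.
Proof. by rewrite -[x]scale1r T_lin !scale1r. Qed.

Lemma linear_sum_of I (r : seq I) (f : I -> U) :
  T (\sum_(i <- r) f i) = \sum_(i <- r) T (f i).
Proof.
elim: r => [|i r IH]; first by rewrite !big_nil linear0_of.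
by rewrite !big_cons linearD_of IH.
Qed.

End LinearOperations.

Section EigenvectorSequences.

Variables (F : fieldType) (V : vectType F) (T : V -> V).
Hypothesis T_lin : forall (c : F) x y, T (c *: x + y) = c *: T x + T y.

(** Applying [T - c_N] kills the last term of a vanishing combination and
    multiplies the others by nonzero scalars. *)
Lemma eigenvector_sum_eq0 N (v : 'I_N -> V) (c a : 'I_N -> F) :
  injective c -> (forall i, T (v i) = c i *: v i) ->
  \sum_i a i *: v i = 0 -> forall i, a i *: v i = 0.
Proof.
elim: N v c a => [|N IH] v c a c_inj eig sum0; first by case.
have low (i : 'I_N) : a (widen_ord (leqnSn N) i) *: v (widen_ord (leqnSn N) i) = 0.
  pose wd := widen_ord (leqnSn N).
  have wd_inj : injective wd by move=> i1 i2 /(congr1 val) /= /val_inj.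
  have := @IH (v \o wd) (c \o wd) (fun i => a (wd i) * (c (wd i) - c ord_max)).
  move=> /(_ (inj_comp c_inj wd_inj) (fun i => eig _)) /=.
  have sum1 : \sum_i (a (wd i) * (c (wd i) - c ord_max)) *: v (wd i) = 0.
    have: T (\sum_i a i *: v i) - c ord_max *: (\sum_i a i *: v i) = 0.
      by rewrite sum0 (linear0_of T_lin) scaler0 subr0.
    rewrite (linear_sum_of T_lin) scaler_sumr -sumrB big_ord_recr /= (linearZ_of T_lin) eig !scalerA.
    rewrite [c ord_max * _]mulrC subrr addr0 => sumT; rewrite -[RHS]sumT.
    apply: eq_bigr => j _.
    by rewrite (linearZ_of T_lin) eig !scalerA -scalerBl mulrBr [c _ * a _]mulrC.
  move=> /(_ sum1 i) /eqP; rewrite mulrC -scalerA scaler_eq0 => /orP[|/eqP //].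
  rewrite subr_eq0 => /eqP /c_inj /(congr1 val) /= eqi.
  by have := ltn_ord i; rewrite eqi ltnn.
move=> i; have [lt_iN | ge_iN] := ltnP i N.
  by rewrite (_ : i = widen_ord (leqnSn N) (Ordinal lt_iN)) ?low //; apply: val_inj.
have -> : i = ord_max by apply: val_inj; apply/eqP; rewrite eqn_leq ge_iN -ltnS ltn_ord.
move: sum0; rewrite big_ord_recr big1 /= => [|j _]; last exact: low.
by rewrite add0r.
Qed.

(** Eigenvectors for distinct eigenvalues are linearly independent, hence
    bounded in number by the dimension. *)
Lemma eigenvector_sequence_vanishes (v : nat -> V) (c : nat -> F) :
  injective c -> (forall k, T (v k) = c k *: v k) -> exists k, v k = 0.
Proof.
move=> c_inj eig; apply: contrapT => nv.
have {}nv k : v k != 0 by apply/eqP => v0; apply: nv; exists k.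
pose N := (dim V).+1.
pose X := [tuple v i | i < N].
have: free X.
  apply/freeP => a sum0 i.
  have := @eigenvector_sum_eq0 N (fun i => v i) (fun i => c i) a.
  have cN_inj : injective (fun i : 'I_N => c i) by move=> j k /c_inj /val_inj.
  move=> /(_ cN_inj (fun i => eig _)) av0.
  apply/eqP; rewrite -(orbF (_ == 0)) -(negPf (nv i)) -scaler_eq0; apply/eqP.
  apply: av0; rewrite -[RHS]sum0; apply: eq_bigr => j _.
  by rewrite (nth_map ord0) ?size_enum_ord ?nth_ord_enum.
move=> /eqP; rewrite size_tuple => dimX.
by have := dimvS (subvf <<X>>%VS); rewrite dimX dimvf ltnn.
Qed.

End EigenvectorSequences.

Section SL2.

Variables (F : numClosedFieldType) (g : vectType F) (br : g -> g -> g).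
Variable h : {vspace g}.
Hypothesis lie_g : is_lie_bracket br.
Implicit Types (x y z : g) (a b c : dual h) (H : subvs_of h).

Lemma br_linl z (k : F) x y : br (k *: x + y) z = k *: br x z + br y z.
Proof. by case: lie_g. Qed.

Lemma br_linr z (k : F) x y : br z (k *: x + y) = k *: br z x + br z y.
Proof. by case: lie_g. Qed.

Lemma brxx x : br x x = 0. Proof. by case: lie_g. Qed.

Lemma brDl z x y : br (x + y) z = br x z + br y z.
Proof. exact: (linearD_of (br_linl z)). Qed.

Lemma brDr z x y : br z (x + y) = br z x + br z y.
Proof. exact: (linearD_of (br_linr z)). Qed.

Lemma brZl z k x : br (k *: x) z = k *: br x z.
Proof. exact: (linearZ_of (br_linl z)). Qed.

Lemma brZr z k x : br z (k *: x) = k *: br z x.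
Proof. exact: (linearZ_of (br_linr z)). Qed.

Lemma br0r z : br z 0 = 0. Proof. exact: (linear0_of (br_linr z)). Qed.

Lemma brC x y : br y x = - br x y.
Proof.
have := brxx (x + y); rewrite brDl !brDr !brxx add0r addr0 => /eqP.
by rewrite addrC addr_eq0 => /eqP.
Qed.

Lemma brNr z x : br z (- x) = - br z x.
Proof. by rewrite -scaleN1r brZr scaleN1r. Qed.

Lemma jacobi x y z : br x (br y z) = br (br x y) z + br y (br x z).
Proof.
case: lie_g => _ _ _ /(_ x y z) /eqP.
rewrite -addrA addr_eq0 => /eqP ->.
by rewrite (brC x z) brNr (brC (br x y) z) opprD opprK addrC opprK.
Qed.

Lemma root_space_br a b x y :
  root_space br a x -> root_space br b y -> root_space br (a + b) (br x y).
Proof.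
by move=> ax bx H; rewrite jacobi ax bx brZl brZr add_lfunE scalerDl.
Qed.

Lemma root_space_iter a b x y k :
  root_space br a x -> root_space br b y ->
  root_space br (b + a *+ k) (iter k (br x) y).
Proof.
move=> ax bx; elim: k => [|k IH] /=; first by rewrite mulr0n addr0.
by rewrite mulrS addrCA; apply: root_space_br.
Qed.

Lemma mulrn_lfunE a k H : (a *+ k) H = a H *+ k.
Proof.
elim: k => [|k IH]; first by rewrite !mulr0n zero_lfunE.
by rewrite !mulrS add_lfunE IH.
Qed.

Lemma eigenvalues_distinct (p q : F) : q != 0 ->
  injective (fun k : nat => p + q *+ k).
Proof.
move=> q0 j k /addrI /eqP; rewrite -!(mulr_natr q) -subr_eq0 -mulrBr mulf_eq0.
by rewrite (negPf q0) subr_eq0 eqr_nat => /eqP.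
Qed.

(** Otherwise the powers would give eigenvectors of [H] for infinitely many
    eigenvalues. *)
Lemma root_space_nilpotent a b x y H :
  a H != 0 -> root_space br a x -> root_space br b y ->
  exists k, iter k (br x) y = 0.
Proof.
move=> aH0 ax bx.
apply: (eigenvector_sequence_vanishes (br_linr (vsval H))
          (@eigenvalues_distinct (b H) _ aH0)) => k.
by rewrite (root_space_iter _ ax bx) add_lfunE mulrn_lfunE.
Qed.

(** The last nonzero term of the sequence of powers of a raising operator. *)
Lemma highest_vector a b x y H :
  a H != 0 -> root_space br a x -> root_space br b y -> y != 0 ->
  exists k, iter k (br x) y != 0 /\ br x (iter k (br x) y) = 0.
Proof.
move=> aH0 ax bx y0; have [k0 ik0] := root_space_nilpotent aH0 ax bx.
have exk : exists k, iter k (br x) y == 0 by exists k0; apply/eqP.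
case: (ex_minnP exk) => -[|k] /eqP ik min_k.
  by rewrite -[y]/(iter 0 (br x) y) ik eqxx in y0.
by exists k; split=> //; apply: contraT; rewrite negbK => /min_k; rewrite ltnn.
Qed.

Section Triple.

Variables (a : dual h) (H : subvs_of h) (e f : g).
Hypothesis aH : a H = 2.
Hypothesis ae : root_space br a e.
Hypothesis af : root_space br (- a) f.
Hypothesis Hef : vsval H = br e f.

(** The commutation relation in a highest weight representation of sl2, for the
    lowering operator [f] applied to a vector killed by [e]. *)
Lemma raise_lower b v k : root_space br b v -> br e v = 0 ->
  br e (iter k.+1 (br f) v) = (k.+1%:R * (b H - k%:R)) *: iter k (br f) v.
Proof.
move=> bv ev; elim: k => [|k IH].
  by rewrite /= jacobi ev br0r addr0 -Hef bv mul1r subr0.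
have := root_space_iter k.+1 af bv => /(_ H).
rewrite [iter k.+2 _ _]iterS jacobi -Hef IH => ->.
rewrite brZr -iterS -scalerDl; congr (_ *: _).
rewrite add_lfunE mulrn_lfunE opp_lfunE aH -mulr_natr -!natr1; ring.
Qed.

(** By [raise_lower], the lowering sequence can only stop at an index equal to the
    highest weight. *)
Lemma highest_weight b v : root_space br b v -> v != 0 -> br e v = 0 ->
  exists N : nat, b H = N%:R /\ forall j, (j <= N)%N -> iter j (br f) v != 0.
Proof.
move=> bv v0 ev.
have aH0 : (- a) H != 0 by rewrite opp_lfunE aH oppr_eq0 pnatr_eq0.
have [N [fN fN1]] := highest_vector aH0 af bv v0.
exists N; split.
  have := raise_lower N bv ev; rewrite iterS fN1 br0r => /esym/eqP.
  rewrite scaler_eq0 (negPf fN) orbF mulf_eq0 pnatr_eq0 /= subr_eq0 => /eqP.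
  by [].
move=> j le_jN; apply: contraNneq fN => fj.
rewrite -(subnK le_jN) iterD fj.
by elim: (N - j)%N => //= k /eqP ->; rewrite br0r.
Qed.

(** Climb to a highest vector of weight [N] in [p] steps and descend [N - p] steps;
    the vector reached is nonzero because [0 <= N - p <= N] when the weight
    [N - 2 p] of [v] is nonnegative. *)
Lemma reflect_root_ge0 b v : root_space br b v -> v != 0 ->
  exists z : int, b H = z%:~R /\
    (0 <= z -> exists2 v', v' != 0 & root_space br (b - b H *: a) v').
Proof.
move=> bv v0; have aH0 : a H != 0 by rewrite aH pnatr_eq0.
have [p [vp0 evp]] := highest_vector aH0 ae bv v0.
have bvp := root_space_iter p ae bv.
have [N [bN fN]] := highest_weight bvp vp0 evp.
rewrite add_lfunE mulrn_lfunE aH in bN.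
have bz : b H = (N%:Z - p.*2%:Z)%:~R.
  by move: bN; rewrite -(mulr_natr 2 p) -natrM mul2n intrB -!pmulrn => <-; rewrite addrK.
exists (N%:Z - p.*2%:Z); split=> //; rewrite subr_ge0 lez_nat => le_pN.
exists (iter (N - p)%N (br f) (iter p (br e) v)); first by apply: fN; apply: leq_subr.
have := root_space_iter (N - p)%N af bvp; congr (root_space br _ _).
rewrite bz mulNrn -addrA; congr (_ + _); rewrite scaler_int.
rewrite !pmulrn -mulrzBr -mulrNz; congr (_ *~ _).
by lia.
Qed.

End Triple.

Lemma coroot_opp a H : is_coroot br a H -> is_coroot br (- a) (- H).
Proof.
move=> [aH [e [f [ae af Hef]]]]; split.
  by rewrite opp_lfunE linearN opprK.
exists f, e; split=> //; first by rewrite opprK.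
by rewrite linearN /= Hef brC opprK.
Qed.

(** The case of a negative weight is the case of a positive one for the opposite
    triple. *)
Lemma reflect_root a H b : is_coroot br a H -> is_root br b ->
  is_root br (b - b H *: a) /\ exists z : int, b H = z%:~R.
Proof.
move=> corH [b0 [v v0 bv]].
have [aH [e [f [ae af Hef]]]] := corH.
have [z [bz refl]] := reflect_root_ge0 aH ae af Hef bv v0.
split; last by exists z.
split.
  apply: contraNneq b0 => /eqP; rewrite subr_eq0 => /eqP eb.
  have := congr1 (fun c : dual h => c H) eb.
  rewrite scale_lfunE aH -[_ *: _]/(b H * 2) mulr_natr mulr2n => bH.
  suff bH0 : b H = 0 by rewrite eb bH0 scale0r.
  apply/esym/(@addrI _ (b H)); rewrite addr0.
  by [].
have [z0|z0] := leP 0 z; first by case: (refl z0) => v'; exists v'.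
have [aH' [e' [f' [ae' af' Hef']]]] := coroot_opp corH.
have [z' [bz' refl']] := reflect_root_ge0 aH' ae' af' Hef' bv v0.
case: refl' => [|v' v'0].
  by move: bz'; rewrite linearN /= bz -intrN => /intr_inj; lia.
have -> : b (- H) = - b H by rewrite linearN.
by rewrite scalerN scaleNr opprK => ?; exists v'.
Qed.

(** Root vectors along an infinite string would have infinitely many distinct
    eigenvalues for some [H]. *)
Lemma root_string_finite a b : a != 0 -> ~ (forall k, is_root br (b + a *+ k)).
Proof.
(* An element of the Cartan subalgebra that separates the terms of the string. *)
move=> a0 roots; have /lfunPn[H aH] : a != 0 by [].
rewrite zero_lfunE in aH.
have ex k : exists x, x != 0 /\ root_space br (b + a *+ k) x.
  by have [_ [x x0 kx]] := roots k; exists x.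
have [v vP] := choice ex.
have [||k vk] := @eigenvector_sequence_vanishes _ _ _ (br_linr (vsval H)) v
  (fun k => b H + a H *+ k); first exact: eigenvalues_distinct.
  by move=> k; have -> := (vP k).2 H; rewrite add_lfunE mulrn_lfunE.
by have := (vP k).1; rewrite vk eqxx.
Qed.

Hypothesis cartan_h : is_cartan br h.

(** The Cartan subalgebra enlarged by a vector that commutes with it is still
    abelian. *)
Lemma root_space0 z : root_space br (0 : dual h) z -> z \in h.
Proof.
move=> z0.
have [h_ab h_max _] := cartan_h.
have zh u : u \in h -> br u z = 0.
  by move=> uh; have := z0 (vsproj h u); rewrite vsprojK // zero_lfunE scale0r.
rewrite -(h_max (h + <[z]>)%VS) ?addvSl //.
  by apply: (subvP (addvSr h _)); apply: memv_line.
move=> _ _ /memv_addP[u uh [_ /vlineP[k ->] ->]] /memv_addP[u' uh' [_ /vlineP[k' ->] ->]].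
rewrite brDl !brDr !brZl !brZr h_ab // zh // (brC u' z) zh // brxx.
by rewrite oppr0 !scaler0 !addr0.
Qed.

(** Take a highest vector of weight [2 c], with [c >= k]. Lowered [c] times it lies
    in the Cartan subalgebra, so lowered once more it is a multiple of [f], which
    [f] kills. As [2 c + 1] lowerings are needed to kill it, [c < 2]. *)
Lemma root_multiple a H k : is_coroot br a H -> is_root br (a *+ k) -> k = 1%N.
Proof.
move=> [aH [e [f [ae af Hef]]]] [ka0 [x x0 kax]].
have k_gt0 : (0 < k)%N by case: k ka0 {kax} => //; rewrite mulr0n eqxx.
have aH0 : a H != 0 by rewrite aH pnatr_eq0.
have [p [v0 ev]] := highest_vector aH0 ae kax x0.
have := root_space_iter p ae kax; rewrite -mulrnDr; set c := (k + p)%N.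
set v := iter p (br e) x in v0 ev * => cv.
have [N [bN fN]] := highest_weight aH af Hef cv v0 ev.
have {bN}eN : N = (c * 2)%N.
  by apply/eqP; rewrite -(eqr_nat F) -bN mulrn_lfunE aH natrM mulr_natl.
have : root_space br (0 : dual h) (iter c (br f) v).
  have := root_space_iter c af cv.
  by rewrite mulNrn subrr.
move=> /root_space0 zh.
have fz : br f (iter c (br f) v) = a (vsproj h (iter c (br f) v)) *: f.
  rewrite brC; have := af (vsproj h (iter c (br f) v)).
  by rewrite vsprojK // => ->; rewrite opp_lfunE scaleNr opprK.
have f0 : iter c.+2 (br f) v = 0 by rewrite !iterS fz brZr brxx scaler0.
have c_lt2 : (c < 2)%N.
  rewrite ltnNge; apply/negP => c2.
  by have: (c.+2 <= N)%N by [lia]; move=> /fN; rewrite f0 eqxx.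
by rewrite /c in c_lt2; lia.
Qed.

End SL2.

(** * Cartan matrices of classical type and type G2 *)

(** The square lengths of the simple roots, in a scale that makes the shortest
    one 1. *)
Definition root_sq (X : lie_type) (n i : nat) : nat :=
  match X with
  | TypeA | TypeD => 1
  | TypeB => if i == n.-1 then 1 else 2
  | TypeC => if i == n.-1 then 2 else 1
  | TypeG2 => if i == 0 then 1 else 3
  end%N.

(** Coefficients of a combination of simple roots whose pairing with each simple
    coroot is positive: outside type G2, concave sequences, whose last terms are
    halved when the end of the diagram requires it. *)
Definition pos_vec (X : lie_type) (n i : nat) : int :=
  match X with
  | TypeA => (i%:Z + 1) * (n%:Z - i%:Z)
  | TypeB => (i%:Z + 1) * (2 * n%:Z - i%:Z)
  | TypeC => if i == n.-1 then n%:Z * (n%:Z + 1)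
             else 2 * (i%:Z + 1) * (2 * n%:Z - i%:Z)
  | TypeD => if (n - 2 <= i)%N then (n%:Z - 1) * (n%:Z + 2)
             else 2 * (i%:Z + 1) * (2 * n%:Z - i%:Z)
  | TypeG2 => if i == 0%N then 5 else 3
  end.

(** Splits on the conditions in the goal and prunes the contradictory branches at
    once, which keeps the number of cases small. *)
Ltac case_ifs := repeat (case: ifP => ?; try (exfalso; lia)).

Section CartanMatrices.

Variables (X : lie_type) (n : nat).
Hypothesis okX : rank_ok X n.
Local Notation C := (cartan_entry X n).

Lemma cartan_diag i : C i i = 2.
Proof. by rewrite /cartan_entry eqxx. Qed.

Lemma cartan_offdiag i j : i != j -> C i j <= 0.
Proof. by rewrite /cartan_entry => /negPf ->; case: X => /=; do ![case: ifP => // _]. Qed.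

Lemma root_sq_gt0 i : (0 < root_sq X n i)%N.
Proof. by rewrite /root_sq; case: X => //; case: ifP. Qed.

Lemma root_sq_sym i j : (i < n)%N -> (j < n)%N ->
  (root_sq X n i)%:Z * C i j = (root_sq X n j)%:Z * C j i.
Proof.
move=> i_n j_n; rewrite /cartan_entry /root_sq (eq_sym j i).
have [->//|ne_ij] := eqVneq i j.
case: X okX => //= okn; do ![case: ifP => /=]; lia.
Qed.

Lemma pos_vec_gt0 i : (i < n)%N -> 0 < pos_vec X n i.
Proof.
move=> i_n; rewrite /pos_vec.
case: X okX => //= okn; do ?[case: ifP => // ?]; rewrite ?mulr_gt0 //; lia.
Qed.

(** Each node of the Dynkin diagram is joined to an earlier one; in type D the last
    node branches off two steps earlier. *)
Lemma cartan_connected i : (0 < i < n)%N -> exists2 p, (p < i)%N & C i p != 0.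
Proof.
move=> /andP[i0 i_n].
pose p := if X is TypeD then if i == n.-1 then (n - 3)%N else i.-1 else i.-1.
exists p; rewrite /p /cartan_entry; case: X okX => //= okn; do ?[case: ifP => //=]; lia.
Qed.

Lemma sum_at (b : bool) (k : nat) (f : nat -> int) :
  \sum_(j < n) (if b && (j == k :> nat) then f j else 0) =
  if b && (k < n)%N then f k else 0.
Proof.
rewrite -big_mkcond /=; case: b => /=; last by rewrite big_pred0.
case: ifP => k_n; first by rewrite (big_pred1 (Ordinal k_n)).
by rewrite big_pred0 // => j; apply: contraFF k_n => /eqP <-.
Qed.

Let isD := if X is TypeD then true else false.

(** The general row of a Cartan matrix has entries on the diagonal and next to it;
    the last two terms account for the branch of the diagram of type D. *)
Lemma cartan_row_sum (i : nat) (f : nat -> int) : (i < n)%N ->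
  \sum_(j < n) C i j * f j =
    2 * f i
    + (if (i.+1 < n)%N then C i i.+1 * f i.+1 else 0)
    + (if (0 < i)%N then C i i.-1 * f i.-1 else 0)
    + (if isD && (i == n - 3)%N then - f n.-1 else 0)
    + (if isD && (i == n.-1) then - f (n - 3)%N else 0).
Proof.
move=> i_n.
have -> : \sum_(j < n) C i j * f j = \sum_(j < n)
   ((if true && (j == i :> nat) then 2 * f j else 0)
   + (if true && (j == i.+1 :> nat) then C i j * f j else 0)
   + (if (0 < i)%N && (j == i.-1 :> nat) then C i j * f j else 0)
   + (if (isD && (i == n - 3)%N) && (j == n.-1 :> nat) then - f j else 0)
   + (if (isD && (i == n.-1)) && (j == n - 3 :> nat)%N then - f j else 0)).
  apply: eq_bigr => -[j /= j_n] _; rewrite /cartan_entry /isD.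
  case: X okX => /= okn; case_ifs; lia.
rewrite !big_split /= (sum_at true _ (fun j => 2 * f j)).
rewrite (sum_at true _ (fun j => C i j * f j)) (sum_at _ _ (fun j => C i j * f j)).
rewrite !(sum_at _ _ (fun j => - f j)) /= i_n.
rewrite /isD; case: X okX => //= okn; case_ifs; lia.
Qed.

Lemma cartan_pos_vec (i : nat) : (i < n)%N ->
  0 < \sum_(j < n) C i j * pos_vec X n j.
Proof.
move=> i_n; rewrite cartan_row_sum //.
rewrite /cartan_entry /pos_vec /isD; case: X okX => //= okn; case_ifs; nia.
Qed.

End CartanMatrices.

(** * From the type to the Cartan integers *)

Definition short_ratio (X : lie_type) : nat := if X is TypeG2 then 3 else 2.

(** What the proof needs to know of a Cartan matrix [A] (with entries
    [alpha_j h_i]): a symmetriser [q], proportional to the square lengths of the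
    simple roots and unique up to a scalar, and a positive vector [u] with
    positive image. *)
Record cartan_datum (X : lie_type) (F : numDomainType) (n : nat)
    (A : 'I_n -> 'I_n -> int) (q u : 'I_n -> int) : Prop := CartanDatum {
  cd_diag : forall i, A i i = 2;
  cd_off : forall i j, i != j -> A i j <= 0;
  cd_sq : forall i, 0 < q i;
  cd_sym : forall i j, q i * A i j = q j * A j i;
  cd_u : forall i, 0 < u i;
  cd_Au : forall i, 0 < \sum_j A i j * u j;
  cd_conn : forall b : 'I_n -> F,
    (forall i j, (A i j)%:~R * b i = (A j i)%:~R * b j) ->
    forall i j, b i * (q j)%:~R = b j * (q i)%:~R;
  cd_ratio : forall i j, q i < q j -> q j = (short_ratio X)%:Z * q i
}.

Lemma root_sq_ratio X n i j : (root_sq X n i < root_sq X n j)%N ->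
  root_sq X n j = (short_ratio X * root_sq X n i)%N.
Proof. by case: X => /=; do ?[case: eqP => /=]. Qed.

(** Follow the edges of the connected Dynkin diagram back to the first node. *)
Lemma cartan_sq_determined (F : numDomainType) X n (b : nat -> F) : rank_ok X n ->
  (forall i j, (i < n)%N -> (j < n)%N ->
     (cartan_entry X n i j)%:~R * b i = (cartan_entry X n j i)%:~R * b j) ->
  forall i, (i < n)%N -> b i * (root_sq X n 0)%:R = b 0%N * (root_sq X n i)%:R.
Proof.
move=> okX b_sym; elim/ltn_ind => -[|i] IH i_n //.
have [p p_lt Cip] : exists2 p, (p < i.+1)%N & cartan_entry X n i.+1 p != 0.
  exact: cartan_connected.
have p_n := ltn_trans p_lt i_n.
have {}IH := IH p p_lt p_n.
have sq0 k : (root_sq X n k)%:R != 0 :> F by rewrite pnatr_eq0 -lt0n root_sq_gt0.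
have := b_sym i.+1 p i_n p_n.
have := congr1 (fun z : int => z%:~R : F) (root_sq_sym okX i_n p_n).
rewrite /= !intrM -!pmulrn.
have c0 : (cartan_entry X n i.+1 p)%:~R != 0 :> F by rewrite intr_eq0.
move: c0 (sq0 p) IH; set c := (cartan_entry X n i.+1 p)%:~R.
set c' := _%:~R; set q0 := (root_sq X n 0)%:R; set qi := (root_sq X n i.+1)%:R.
set qp := _%:R => c0 qp0 IH eq1 eq2; apply: (mulfI c0); apply: (mulfI qp0).
have -> : qp * (c * (b i.+1 * q0)) = qp * (c * b i.+1) * q0 by ring.
have -> : qp * (c * (b 0%N * qi)) = qp * (qi * c) * b 0%N by ring.
rewrite eq1 eq2.
have -> : qp * (c' * b p) * q0 = qp * c' * (b p * q0) by ring.
by rewrite IH; ring.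
Qed.

Lemma type_cartan_datum (F : numClosedFieldType) (g : vectType F)
    (h : {vspace g}) n X (alpha : 'I_n -> dual h) hc : has_type X alpha hc ->
  exists A q u, cartan_datum X F A q u /\
    forall i j, alpha j (hc i) = (A i j)%:~R.
Proof.
move=> [okX [s sC]].
pose t := (s^-1)%g.
exists (fun i j => cartan_entry X n (t i) (t j)), (fun i => (root_sq X n (t i))%:Z),
  (fun i => pos_vec X n (t i)); split; last first.
  by move=> i j; rewrite -sC !permKV.
split=> [i|i j ne_ij|i|i j|i|i|b b_sym i j|i j].
- exact: cartan_diag.
- by apply: cartan_offdiag; rewrite (inj_eq val_inj) (inj_eq perm_inj).
- by rewrite ltz_nat root_sq_gt0.
- exact: root_sq_sym.
- exact: pos_vec_gt0.
- rewrite (reindex_perm s) /=.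
  by under eq_bigr => j _ do rewrite permK; apply: cartan_pos_vec.
- rewrite -!pmulrn.
  pose b' k : F := if insub k is Some k' then b (s k') else 0.
  have b'E (k : 'I_n) : b' k = b (s k) by rewrite /b' valK.
  have b't k : b' (t k) = b k by rewrite b'E permKV.
  have key := @cartan_sq_determined F X n b' okX.
  have {}key : forall i, (i < n)%N -> b' i * (root_sq X n 0)%:R = b' 0%N * (root_sq X n i)%:R.
    apply: key => k m k_n m_n.
    by have := b_sym (s (Ordinal k_n)) (s (Ordinal m_n)); rewrite !permK -!b'E.
  have := key (t i) (ltn_ord _); have := key (t j) (ltn_ord _); rewrite !b't.
  have sq0 : (root_sq X n 0)%:R != 0 :> F by rewrite pnatr_eq0 -lt0n root_sq_gt0.
  move=> ej ei; apply: (mulIf sq0).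
  by rewrite mulrAC ei mulrAC -ej; ring.
by rewrite ltz_nat => /root_sq_ratio ->; rewrite PoszM.
Qed.

(** * Integral quadratic forms and nonnegative spans *)

Section PositiveDefinite.

Variables (n : nat) (S : 'I_n -> 'I_n -> int) (u : 'I_n -> int).
Hypothesis S_sym : forall i j, S i j = S j i.
Hypothesis S_off : forall i j, i != j -> S i j <= 0.
Hypothesis u_gt0 : forall i, 0 < u i.
Hypothesis Su_gt0 : forall i, 0 < \sum_j S i j * u j.

Let a (i : 'I_n) : rat := (\sum_j S i j * u j)%:~R / (u i)%:~R.

Lemma slope_gt0 i : 0 < a i.
Proof. by rewrite divr_gt0 // ltr0z. Qed.

(** With [t_i = x_i / u_i], the inequality [t_i t_j <= (t_i^2 + t_j^2) / 2], reversed
    by the nonpositive coefficient off the diagonal, bounds the form below by a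
    diagonal one whose coefficients are those of [S u] divided by [u]. *)
Lemma quad_ge (x : 'I_n -> int) :
  \sum_i a i * (x i)%:~R ^+ 2 <= (\sum_i \sum_j S i j * x i * x j)%:~R.
Proof.
pose t i : rat := (x i)%:~R / (u i)%:~R.
have u0 i : (u i)%:~R != 0 :> rat by rewrite intr_eq0 gt_eqF.
have xE i : (x i)%:~R = t i * (u i)%:~R by rewrite /t mulfVK.
pose w i j : rat := (S i j * u i * u j)%:~R.
have -> : (\sum_i \sum_j S i j * x i * x j)%:~R = \sum_i \sum_j w i j * (t i * t j).
  rewrite (rmorph_sum intr); apply: eq_bigr => i _; rewrite (rmorph_sum intr).
  apply: eq_bigr => j _; rewrite /w /= !intrM. rewrite (xE i) (xE j); ring.
have half : \sum_i a i * (x i)%:~R ^+ 2 = \sum_i \sum_j w i j * t i ^+ 2.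
  apply: eq_bigr => i _; rewrite -mulr_suml /a xE (rmorph_sum intr) !mulr_suml.
  apply: eq_bigr => j _.
  by rewrite /w !intrM; have := u0 i; move: (t i) => ti ui; field.
have half' : \sum_i a i * (x i)%:~R ^+ 2 = \sum_i \sum_j w i j * t j ^+ 2.
  rewrite half exchange_big /=; apply: eq_bigr => i _; apply: eq_bigr => j _.
  by rewrite /w S_sym; congr (_%:~R * _); ring.
suff: \sum_i \sum_j w i j * t i ^+ 2 + \sum_i \sum_j w i j * t j ^+ 2
      <= \sum_i \sum_j w i j * (t i * t j) + \sum_i \sum_j w i j * (t i * t j).
  by rewrite -half -half'; lra.
rewrite -!big_split; apply: ler_sum => i _; rewrite -!big_split; apply: ler_sum => j _ /=.
have [<-|ne_ij] := eqVneq i j; first by rewrite expr2.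
have w_le0 : w i j <= 0.
  by rewrite /w -mulrA intrM mulr_le0_ge0 ?lerz0 ?S_off // ler0z mulr_ge0 ?ltW.
have := sqr_ge0 (t i - t j); nra.
Qed.

(** Complete the square in each coordinate of the diagonal lower bound. *)
Lemma quad_bounded (k : nat) (l : 'I_n -> int) : (0 < k)%N ->
  exists C : int, forall x : 'I_n -> int,
    C <= k%:Z * (\sum_i \sum_j S i j * x i * x j) + \sum_i l i * x i.
Proof.
move=> k0.
pose D : rat := \sum_i - ((l i)%:~R ^+ 2 / (4 * a i)).
exists (Num.floor D) => x; rewrite -(ler_int rat).
apply: le_trans (floor_le D) _.
rewrite intrD intrM [X in _ + X](rmorph_sum intr) /=.
have k1 : 1 <= (k%:Z)%:~R :> rat by rewrite -pmulrn ler1n.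
have q0 : 0 <= \sum_i a i * (x i)%:~R ^+ 2.
  by apply: sumr_ge0 => j _; rewrite mulr_ge0 ?sqr_ge0 ?ltW ?slope_gt0.
apply: (@le_trans _ _ (\sum_i a i * (x i)%:~R ^+ 2 + \sum_i (l i * x i)%:~R)).
  rewrite -big_split; apply: ler_sum => i _ /=; have ai := slope_gt0 i.
  rewrite intrM; set y := _%:~R; set z := _%:~R.
  have -> : - (y ^+ 2 / (4 * a i)) = a i * z ^+ 2 + y * z - (2 * a i * z + y) ^+ 2 / (4 * a i).
    by field; rewrite gt_eqF.
  by rewrite gerBl divr_ge0 ?sqr_ge0 // mulr_ge0 ?ltW.
rewrite lerD2r; apply: le_trans (quad_ge x) _.
rewrite -[leLHS]mul1r ler_wpM2r //; exact: le_trans q0 (quad_ge x).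
Qed.

End PositiveDefinite.

Lemma bounded_int_minimum (T : Type) (P : T -> Prop) (f : T -> int) (C : int) :
  (exists t, P t) -> (forall t, P t -> C <= f t) ->
  exists t, P t /\ forall t', P t' -> f t <= f t'.
Proof.
move=> [t0 Pt0] C_le.
pose Q k := `[< exists2 t, P t & f t = C + k%:Z >].
have fE t : P t -> f t = C + `|f t - C|%N%:Z by move=> /C_le; lia.
have exQ : exists k, Q k by exists `|f t0 - C|%N; apply/asboolP; exists t0; auto.
case: (ex_minnP exQ) => k /asboolP[t Pt ft] min_k; exists t; split=> // t' Pt'.
have /min_k kle : Q `|f t' - C|%N by apply/asboolP; exists t'; auto.
by rewrite ft (fE t' Pt') lerD2l lez_nat.
Qed.

Lemma nat_spanD (V : nmodType) (S : V -> Prop) x y :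
  nat_span S x -> nat_span S y -> nat_span S (x + y).
Proof.
move=> [s [sS ->]] [t [tS ->]]; exists (s ++ t); split; last by rewrite big_cat.
by move=> z; rewrite mem_cat => /orP[/sS|/tS].
Qed.

Lemma nat_span_in (V : nmodType) (S : V -> Prop) x : S x -> nat_span S x.
Proof.
by exists [:: x]; split; [move=> y; rewrite inE => /eqP -> | rewrite big_seq1].
Qed.

Lemma nat_span_muln (V : nmodType) (S : V -> Prop) x k : S x -> nat_span S (x *+ k).
Proof.
move=> Sx; elim: k => [|k IH]; first by exists [::]; split; rewrite ?big_nil.
by rewrite mulrS; apply: nat_spanD => //; apply: nat_span_in.
Qed.

Lemma nat_span_sum (V : nmodType) (I : finType) (S : V -> Prop) (v : I -> V) m :
  (forall i, S (v i)) -> nat_span S (\sum_i v i *+ m i).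
Proof.
move=> Sv; apply: (big_ind (nat_span S)) => [|x y|i _]; last exact: nat_span_muln.
  by exists [::]; split; rewrite ?big_nil.
exact: nat_spanD.
Qed.

Lemma nat_span_familyP (V : nmodType) (I : finType) (v : I -> V) x :
  nat_span (fun y => exists i, y = v i) x -> exists m, x = \sum_i v i *+ m i.
Proof.
move=> [s [sS ->]]; elim: s sS => [|y s IH] sS.
  by exists (fun=> 0%N); rewrite big_nil big1.
have [|m mE] := IH; first by move=> z zs; apply: sS; rewrite inE zs orbT.
have [i yE] : exists i, y = v i by apply: sS; rewrite inE eqxx.
exists (fun j => m j + (j == i))%N; rewrite big_cons mE yE.
under [RHS]eq_bigr => j _ do rewrite mulrnDr.
rewrite big_split /= addrC; congr (_ + _).
rewrite (bigD1 i) //= eqxx mulr1n big1 ?addr0 // => j /negPf ->.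
by rewrite mulr0n.
Qed.

(** * Roots and simple reflections *)

Section SimpleReflections.

Variables (F : numClosedFieldType) (g : vectType F) (h : {vspace g}) (n : nat).
Variables (alpha : 'I_n -> dual h) (hc : 'I_n -> subvs_of h).
Hypothesis alpha_hc : forall i, alpha i (hc i) = 2.
Local Notation refl := (simple_reflection alpha hc).
Local Notation word := (weyl_word alpha hc).
Implicit Types x y : dual h.

Lemma labelD x y i : (x + y) (hc i) = x (hc i) + y (hc i).
Proof. exact: add_lfunE. Qed.

Lemma labelN x i : (- x) (hc i) = - x (hc i).
Proof. exact: opp_lfunE. Qed.

Lemma labelZ (k : F) x i : (k *: x) (hc i) = k * x (hc i).
Proof. exact: scale_lfunE. Qed.

Lemma refl_linear i (k : F) x y : refl i (k *: x + y) = k *: refl i x + refl i y.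
Proof.
rewrite /simple_reflection labelD labelZ scalerDl scalerBr scalerA opprD.
by rewrite addrACA.
Qed.

Lemma reflK i : involutive (refl i).
Proof.
move=> x; rewrite /simple_reflection labelD labelN labelZ alpha_hc.
by rewrite mulrC mulr_natl mulr2n opprD addNKr scaleNr opprK subrK.
Qed.

Lemma refl_alpha i : refl i (alpha i) = - alpha i.
Proof.
by rewrite /simple_reflection alpha_hc scaler_nat mulr2n opprD addNKr.
Qed.

Lemma word_linear s (k : F) x y : word s (k *: x + y) = k *: word s x + word s y.
Proof. by elim: s => //= i s ->; rewrite refl_linear. Qed.

Lemma wordD s x y : word s (x + y) = word s x + word s y.
Proof. exact: (linearD_of (word_linear s)). Qed.

Lemma wordZ s k x : word s (k *: x) = k *: word s x.
Proof. exact: (linearZ_of (word_linear s)). Qed.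

Lemma wordN s x : word s (- x) = - word s x.
Proof. by rewrite -scaleN1r wordZ scaleN1r. Qed.

Lemma word_cat s t x : word (s ++ t) x = word s (word t x).
Proof. exact: foldr_cat. Qed.

Lemma wordK s : cancel (word s) (word (rev s)).
Proof.
elim: s => //= i s IH x.
by rewrite rev_cons -cats1 word_cat /= reflK IH.
Qed.

Lemma wordVK s : cancel (word (rev s)) (word s).
Proof. by move=> x; rewrite -{1}(revK s) wordK. Qed.

Lemma in_weyl_word s : in_weyl alpha hc (word s).
Proof. by exists s. Qed.

End SimpleReflections.

Section RootCombinatorics.

Variables (F : numClosedFieldType) (g : vectType F) (br : g -> g -> g).
Variables (h : {vspace g}) (n : nat).
Variables (alpha : 'I_n -> dual h) (hc : 'I_n -> subvs_of h).
Variables (X : lie_type) (A : 'I_n -> 'I_n -> int) (q u : 'I_n -> int).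
Hypothesis lie_g : is_lie_bracket br.
Hypothesis cartan_h : is_cartan br h.
Hypothesis simple_alpha : is_simple_roots br alpha.
Hypothesis coroot_hc : forall i, is_coroot br (alpha i) (hc i).
Hypothesis alphaA : forall i j, alpha j (hc i) = (A i j)%:~R.
Hypothesis CD : cartan_datum X F A q u.
Local Notation refl := (simple_reflection alpha hc).
Local Notation word := (weyl_word alpha hc).
Local Notation root_ge0 := (root_lattice_ge0 alpha).
Implicit Types x y : dual h.

Lemma alpha_hc i : alpha i (hc i) = 2.
Proof. by case: (coroot_hc i). Qed.

Let basis := [tuple alpha i | i < n].

Lemma alpha_basis : basis_of fullv basis.
Proof. by case: simple_alpha. Qed.

Lemma basisE (i : 'I_n) : basis`_i = alpha i.
Proof. by rewrite -tnth_nth tnth_mktuple. Qed.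

Definition coef i x : F := coord basis i x.

Lemma coefD i x y : coef i (x + y) = coef i x + coef i y.
Proof. by rewrite /coef linearD. Qed.

Lemma coefZ i k x : coef i (k *: x) = k * coef i x.
Proof. by rewrite /coef linearZ. Qed.

Lemma coefN i x : coef i (- x) = - coef i x.
Proof. by rewrite /coef linearN. Qed.

Lemma coef_alpha i j : coef i (alpha j) = (i == j)%:R.
Proof.
by rewrite /coef -basisE coord_free ?(basis_free alpha_basis) // eq_sym.
Qed.

Lemma coef_expansion x : x = \sum_i coef i x *: alpha i.
Proof.
rewrite {1}(coord_basis alpha_basis (memvf x)).
by apply: eq_bigr => i _; rewrite basisE.
Qed.

Lemma coef_sum i (m : 'I_n -> nat) : coef i (\sum_j alpha j *+ m j) = (m i)%:R.
Proof.
rewrite /coef linear_sum /= (bigD1 i) //= big1 ?addr0 => [|j ne_ji].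
  by rewrite linearMn /= -/(coef i _) coef_alpha eqxx.
by rewrite linearMn /= -/(coef i _) coef_alpha eq_sym (negPf ne_ji) mul0rn.
Qed.

Lemma root_ge0_coef i x : root_ge0 x -> 0 <= coef i x.
Proof. by move=> /nat_span_familyP[m ->]; rewrite coef_sum. Qed.

Lemma coef_refl i j x : i != j -> coef i (refl j x) = coef i x.
Proof.
move=> /negPf ne_ij.
by rewrite coefD coefN coefZ coef_alpha ne_ij mulr0 subr0.
Qed.

(** A simple reflection changes a single coefficient. *)
Lemma refl_sign_change j x : root_ge0 x -> root_ge0 (- refl j x) ->
  x = coef j x *: alpha j.
Proof.
move=> x_ge0 sx_le0; rewrite {1}[x]coef_expansion (bigD1 j) //= big1 ?addr0 //.
move=> i ne_ij; suff -> : coef i x = 0 by rewrite scale0r.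
apply/le_anti; rewrite root_ge0_coef // andbT.
by have := root_ge0_coef i sx_le0; rewrite coefN coef_refl // oppr_ge0.
Qed.

Lemma label_sum i (m : 'I_n -> nat) :
  (\sum_j alpha j *+ m j) (hc i) = (\sum_j A i j * (m j)%:Z)%:~R.
Proof.
rewrite sum_lfunE (rmorph_sum intr); apply: eq_bigr => j _ /=.
by rewrite mulrn_lfunE alphaA intrM -pmulrn mulr_natr.
Qed.

(** Pair with the strictly positive combination of coroots with coefficients
    [q i * u i], on which every simple root is positive. *)
Lemma positive_label (m : 'I_n -> nat) :
  \sum_j alpha j *+ m j != 0 ->
  exists i k, (\sum_j alpha j *+ m j) (hc i) = k.+1%:R.
Proof.
move=> m0.
(* If no label is positive, neither is the weighted sum of the labels. *)
have [i Am_gt0] : exists i, 0 < \sum_j A i j * (m j)%:Z.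
  apply: contrapT => nAm.
  have le0 i : \sum_j A i j * (m j)%:Z <= 0.
    by rewrite leNgt; apply/negP => gt0; apply: nAm; exists i.
  have : \sum_i q i * u i * (\sum_j A i j * (m j)%:Z) <= 0.
    apply: sumr_le0 => i _; rewrite mulr_ge0_le0 // mulr_ge0 // ltW //.
      exact: (cd_sq CD).
    exact: (cd_u CD).
  apply/negP; rewrite -ltNge.
  (* Exchanging the sums through the symmetriser makes the image of u appear. *)
  have -> : \sum_i q i * u i * (\sum_j A i j * (m j)%:Z) =
            \sum_j (m j)%:Z * q j * (\sum_i A j i * u i).
    under eq_bigr => i _ do rewrite mulr_sumr.
    rewrite exchange_big /=; apply: eq_bigr => j _; rewrite mulr_sumr.
    apply: eq_bigr => i _.
    have -> : q i * u i * (A i j * (m j)%:Z) = q i * A i j * u i * (m j)%:Z by ring.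
    by rewrite (cd_sym CD); ring.
  have term_ge0 j : 0 <= (m j)%:Z * q j * (\sum_i A j i * u i).
    by rewrite mulr_ge0 ?mulr_ge0 // ltW ?(cd_sq CD) // (cd_Au CD).
  have [j mj0] : exists j, m j != 0%N.
    apply: contrapT => nm; case/eqP: m0; apply: big1 => j _.
    have [->|mj] := eqVneq (m j) 0%N; first by rewrite mulr0n.
    by case: nm; exists j.
  rewrite (bigD1 j) //= ltr_pwDl ?sumr_ge0 //.
  by rewrite !mulr_gt0 ?(cd_sq CD) ?(cd_Au CD) // ltz_nat lt0n.
pose z := \sum_j A i j * (m j)%:Z.
exists i, (`|z|%N.-1); rewrite -/z in Am_gt0.
by rewrite label_sum -/z prednK ?absz_gt0 ?gt_eqF // pmulrn gez0_abs // ltW.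
Qed.

(** Roots are closed under negation only a posteriori; the symmetric closure lets
    positive and negative roots be treated by the same descent. *)
Definition root_up_to_sign x := is_root br x \/ is_root br (- x).

Lemma root_refl i x : is_root br x -> is_root br (refl i x).
Proof. by move=> /(reflect_root lie_g (coroot_hc i)) []. Qed.

Lemma refl_opp i x : refl i (- x) = - refl i x.
Proof. exact: (wordN alpha hc [:: i]). Qed.

Lemma root_word s x : is_root br x -> is_root br (word s x).
Proof. by elim: s x => //= i s IH x /IH; apply: root_refl. Qed.

Lemma up_to_sign_refl i x : root_up_to_sign x -> root_up_to_sign (refl i x).
Proof. by case=> /(root_refl i); [left | right; rewrite -refl_opp]. Qed.

Lemma up_to_sign_dichotomy x :
  root_up_to_sign x -> root_ge0 x \/ root_ge0 (- x).
Proof.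
have [_ _ dich] := simple_alpha.
by case=> /dich; rewrite ?opprK // => -[]; auto.
Qed.

Lemma up_to_sign_multiple i k : root_up_to_sign (alpha i *+ k) -> k = 1%N.
Proof.
case; first exact: (root_multiple lie_g cartan_h (coroot_hc i)).
rewrite -mulNrn.
exact: (root_multiple lie_g cartan_h (coroot_opp lie_g (coroot_hc i))).
Qed.

Lemma up_to_sign_neq0 x : root_up_to_sign x -> x != 0.
Proof. by case=> -[]; rewrite ?oppr_eq0. Qed.

(** Lower the height by simple reflections with a positive label; this is only
    stopped by a root whose reflection is negative, a multiple of a simple root,
    hence a simple root. *)
Lemma ge0_root_conj x : root_ge0 x -> root_up_to_sign x ->
  exists s i, x = word s (alpha i).
Proof.
move=> /nat_span_familyP[m ->] {x}.
have [N mN] := ubnP (\sum_j m j)%N; elim: N => // N IH in m mN *.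
move Ex: (\sum_j _) => x x_root.
have x_neq0 := up_to_sign_neq0 x_root.
have [i [k xi]] : exists i k, x (hc i) = k.+1%:R.
  by rewrite -Ex in x_neq0 *; apply: positive_label.
have sx_root := up_to_sign_refl i x_root.
case: (up_to_sign_dichotomy sx_root) => [|sx_le0].
  move=> /nat_span_familyP[m' sxE].
  have [||s [j eq_sx]] := IH m'; last first.
  - by exists (i :: s), j; rewrite /= -eq_sx -sxE reflK //; apply: alpha_hc.
  - by rewrite -sxE.
  have mE j : (m j = m' j + (j == i) * k.+1)%N.
    apply/eqP; rewrite -(eqr_nat F) natrD natrM -!coef_sum -sxE Ex.
    by rewrite coefD coefN coefZ coef_alpha xi mulrC subrK.
  rewrite ltnS in mN; apply: leq_trans mN; rewrite (eq_bigr _ (fun j _ => mE j)).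
  rewrite big_split /= -addn1 leq_add2l (bigD1 i) //= eqxx mul1n.
  by apply: leq_trans (leq_addr _ _).
have xE : x = alpha i *+ m i.
  have := refl_sign_change (x := x) (j := i) _ sx_le0.
  rewrite -Ex coef_sum scaler_nat; apply; apply: nat_span_sum => j.
  by exists j.
exists [::], i; move: x_root; rewrite xE => /up_to_sign_multiple ->.
by rewrite mulr1n.
Qed.

Lemma root_conj_simple x : is_root br x -> exists s i, x = word s (alpha i).
Proof.
move=> x_root.
case: (up_to_sign_dichotomy (or_introl x_root)) => x_ge0.
  exact: ge0_root_conj x_ge0 (or_introl x_root).
have [|s [i xE]] := ge0_root_conj x_ge0; first by right; rewrite opprK.
exists (s ++ [:: i]), i.
by rewrite word_cat /= (refl_alpha alpha_hc) wordN -xE opprK.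
Qed.

(** * The invariant form and the lengths of the simple roots *)

Variable B : dual h -> dual h -> F.
Hypothesis form_B : is_normalized_form br alpha hc B.
Local Notation d := (dcoef X B alpha).

Lemma form_linear (k : F) x y z : B (k *: x + y) z = k * B x z + B y z.
Proof. by case: form_B. Qed.

Lemma formC x y : B x y = B y x.
Proof. by case: form_B. Qed.

Lemma formDl x y z : B (x + y) z = B x z + B y z.
Proof. exact: (@linearD_of _ _ F^o (B^~ z) (fun k x y => form_linear k x y z)). Qed.

Lemma formZl k x z : B (k *: x) z = k * B x z.
Proof. exact: (@linearZ_of _ _ F^o (B^~ z) (fun k x y => form_linear k x y z)). Qed.

Lemma formDr x y z : B z (x + y) = B z x + B z y.
Proof. by rewrite formC formDl !(formC _ z). Qed.

Lemma formZr k x z : B z (k *: x) = k * B z x.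
Proof. by rewrite formC formZl (formC _ z). Qed.

Lemma formNl x z : B (- x) z = - B x z.
Proof. by rewrite -scaleN1r formZl mulN1r. Qed.

Lemma formNr x z : B z (- x) = - B z x.
Proof. by rewrite formC formNl (formC _ z). Qed.

Lemma form0l z : B 0 z = 0.
Proof. by rewrite -(scale0r 0) formZl mul0r. Qed.

Lemma form_suml I (r : seq I) (f : I -> dual h) z :
  B (\sum_(i <- r) f i) z = \sum_(i <- r) B (f i) z.
Proof. exact: (@linear_sum_of _ _ F^o (B^~ z) (fun k x y => form_linear k x y z)). Qed.

Lemma form_sumr I (r : seq I) (f : I -> dual h) z :
  B z (\sum_(i <- r) f i) = \sum_(i <- r) B z (f i).
Proof. by rewrite formC form_suml; apply: eq_bigr => i _; rewrite formC. Qed.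

Lemma form_word s x y : B (word s x) (word s y) = B x y.
Proof. by have [_ _ invB _ _] := form_B; apply: invB; exists s. Qed.

Lemma form_word_adj s x y : B (word s x) y = B x (word (rev s) y).
Proof. by rewrite -[y in LHS](wordVK alpha_hc s) form_word. Qed.

(** Invariance under a simple reflection determines the form against the simple
    root from the coroot. *)
Lemma form_alpha x i : B x (alpha i) * 2 = x (hc i) * B (alpha i) (alpha i).
Proof.
have := form_word [:: i] x (alpha i); rewrite /= (refl_alpha alpha_hc).
rewrite /simple_reflection formNr formDl formNl formZl => /eqP.
rewrite opprD opprK addrC subr_eq => /eqP ->.
by rewrite mulr_natr mulr2n.
Qed.

(** The square lengths symmetrise the Cartan matrix, hence are proportional to
    [q]. *)
Lemma simple_sq_conn i j :
  B (alpha i) (alpha i) * (q j)%:~R = B (alpha j) (alpha j) * (q i)%:~R.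
Proof.
apply: (cd_conn CD (b := fun i => B (alpha i) (alpha i))) => {}i {}j.
by rewrite -!alphaA -!form_alpha formC.
Qed.

Lemma root_sq_simple x : is_root br x ->
  exists i, B x x = B (alpha i) (alpha i).
Proof. by move=> /root_conj_simple[s [i ->]]; exists i; rewrite form_word. Qed.

Lemma long_simple : exists i, B (alpha i) (alpha i) = 2.
Proof.
have [_ _ _ [x x_root Bx] _] := form_B.
by have [i Bi] := root_sq_simple x_root; exists i; rewrite -Bi.
Qed.

Lemma q_neq0 i : (q i)%:~R != 0 :> F.
Proof. by rewrite intr_eq0 gt_eqF // (cd_sq CD). Qed.

(** The longest simple roots have square length 2, as every root has the length of a
    simple one; the others are shorter by the ratio of the type. *)
Lemma dcoef_sq j : (d j)%:R * B (alpha j) (alpha j) = 2.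
Proof.
have [i Bi] := long_simple.
have [_ simple_root _] := simple_alpha; have [_ _ _ _ B_le2] := form_B.
have := simple_sq_conn j i; rewrite Bi /dcoef.
have [-> _|ne_Bj Bj] := eqVneq (B (alpha j) (alpha j)) 2; first by rewrite mul1r.
have q_lt : q j < q i.
  rewrite lt_neqAle; apply/andP; split.
    apply: contraNneq ne_Bj => qE; apply/eqP; apply: (mulIf (q_neq0 i)).
    by rewrite Bj qE.
  rewrite -(ler_int F) -(ler_pM2l (x := 2%:R)) ?ltr0n // -Bj.
  by rewrite ler_wpM2r ?B_le2 // ler0z ltW ?(cd_sq CD).
have {}q_lt := cd_ratio CD q_lt; rewrite q_lt intrM in Bj.
have -> : (if X is TypeG2 then 3%N else 2%N) = short_ratio X by [].
apply: (mulIf (q_neq0 j)); rewrite -Bj -pmulrn; ring.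
Qed.

Lemma dcoef_gt0 j : (0 < d j)%N.
Proof.
rewrite lt0n; apply/negP => /eqP d0; have := dcoef_sq j.
by rewrite d0 mul0r => /esym/eqP; rewrite pnatr_eq0.
Qed.

Lemma simple_sq j : B (alpha j) (alpha j) = 2 / (d j)%:R.
Proof. by rewrite -(dcoef_sq j) mulrC mulKf // pnatr_eq0 -lt0n dcoef_gt0. Qed.

(** The simple coroot carried to the dual by the form; see [form_co]. *)
Definition coroot j : dual h := alpha j *+ d j.

Lemma form_co x j : B x (coroot j) = x (hc j).
Proof.
have two0 : 2 != 0 :> F by rewrite pnatr_eq0.
apply: (mulIf two0); rewrite /coroot -scaler_nat formZr -mulrA form_alpha.
by rewrite mulrCA dcoef_sq.
Qed.

Lemma form_simple x j : B x (alpha j) = x (hc j) / (d j)%:R.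
Proof.
have d0 : (d j)%:R != 0 :> F by rewrite pnatr_eq0 -lt0n dcoef_gt0.
by rewrite -form_co /coroot -scaler_nat formZr mulrC mulKf.
Qed.

(** * The exchange property and the longest element *)

Definition reflection y x : dual h := x - (2 * B x y / B y y) *: y.

Lemma reflection_word s y x :
  reflection (word s y) (word s x) = word s (reflection y x).
Proof. by rewrite /reflection !form_word wordD wordN wordZ. Qed.

Lemma reflection_multiple (k : F) j x : k != 0 ->
  reflection (k *: alpha j) x = refl j x.
Proof.
move=> k0; rewrite /reflection /simple_reflection scalerA; congr (_ - _ *: _).
rewrite formZl !formZr simple_sq form_simple.
have d0 : (d j)%:R != 0 :> F by rewrite pnatr_eq0 -lt0n dcoef_gt0.
by field; rewrite d0 k0.
Qed.

(** The exchange property: follow the positive root through the word until the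
    letter that makes it negative, and delete that letter. *)
Lemma exchange s y : is_root br y -> root_ge0 y -> root_ge0 (- word (rev s) y) ->
  exists2 s', (size s' < size s)%N & forall x, reflection y (word s x) = word s' x.
Proof.
have [_ _ dich] := simple_alpha.
elim: s y => [|j s IH] y y_root y_ge0 y_lt0.
  case: y_root => /eqP[]; rewrite [y]coef_expansion big1 // => i _.
  suff -> : coef i y = 0 by rewrite scale0r.
  apply/le_anti; rewrite root_ge0_coef // andbT.
  by have := root_ge0_coef i y_lt0; rewrite coefN oppr_ge0.
rewrite rev_cons -cats1 word_cat /= in y_lt0.
have sy_root := root_refl j y_root.
case: (dich _ sy_root) => [sy_ge0|sy_lt0].
  have [s' lt_s' s'E] := IH _ sy_root sy_ge0 y_lt0.
  exists (j :: s') => //= x; rewrite -s'E.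
  have /= <- := reflection_word [:: j].
  by rewrite (reflK alpha_hc).
exists s => //= x; rewrite (refl_sign_change y_ge0 sy_lt0).
rewrite reflection_multiple ?(reflK alpha_hc) //.
apply/eqP => y0; have := refl_sign_change y_ge0 sy_lt0.
by rewrite y0 scale0r => yE; case: y_root; rewrite yE eqxx.
Qed.

Lemma weyl_length_exists w : in_weyl alpha hc w -> exists k, weyl_length alpha hc w k.
Proof.
move=> [s ws].
pose P k := `[< exists2 t, size t = k & w =1 word t >].
have exP : exists k, P k by exists (size s); apply/asboolP; exists s.
case: (ex_minnP exP) => k /asboolP wk min_k; exists k; split=> // t wt.
by apply: min_k; apply/asboolP; exists t.
Qed.

(** If the image of [alpha_i] under the inverse of [w0] were positive, then [s_i w0]
    would be longer than [w0]: the exchange property applied to a reduced word of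
    [s_i w0] yields a strictly shorter word for [w0]. So this image is negative,
    and a dominant weight pairs nonpositively with it. *)
Lemma longest_antidominant w0 x i : is_longest alpha hc w0 ->
  (forall j, 0 <= x (hc j)) -> w0 x (hc i) <= 0.
Proof.
move=> [w0_in longest] x_dom.
have [k0 w0_len] := weyl_length_exists w0_in.
have [[s sz_s w0E] min_k0] := w0_len.
have [_ simple_root dich] := simple_alpha.
pose y := word (rev s) (alpha i).
have y_root : is_root br y by apply: root_word; apply: simple_root.
case: (dich _ y_root) => [y_ge0|].
  have wi : in_weyl alpha hc (refl i \o w0).
    by exists (i :: s) => z /=; rewrite w0E.
  have [k wi_len] := weyl_length_exists wi.
  have le_k := longest _ _ _ wi_len w0_len.
  have [[t sz_t tE] _] := wi_len.
  have yE : word (rev t) (alpha i) = - y.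
    rewrite -[RHS](wordK alpha_hc t) -tE /= w0E wordN /y wordVK; last exact: alpha_hc.
    by rewrite refl_opp (refl_alpha alpha_hc) opprK.
  have [||s' lt_s' s'E] := exchange (s := t) (simple_root i).
  - by apply: nat_span_in; exists i.
  - by rewrite yE opprK.
  have: (k0 <= size s')%N.
    apply: min_k0 => z; rewrite -s'E -tE /= -[alpha i]scale1r.
    by rewrite reflection_multiple ?oner_eq0 // (reflK alpha_hc).
  by rewrite leqNgt (leq_trans lt_s') // sz_t.
move=> /nat_span_familyP[m mE].
rewrite w0E -form_co form_word_adj /coroot -scaler_nat wordZ formZr -/y.
rewrite -[y]opprK mE formNr mulrN oppr_le0 mulr_ge0 ?ler0n // form_sumr.
apply: sumr_ge0 => j _.
by rewrite -scaler_nat formZr form_simple mulr_ge0 ?ler0n // divr_ge0 ?ler0n.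
Qed.

Definition lattice (m : 'I_n -> int) : dual h := \sum_i (m i)%:~R *: alpha i.

Definition in_lattice x := exists m, x = lattice m.

Lemma in_lattice_sum I (r : seq I) (f : I -> dual h) (m : I -> int) :
  (forall i, in_lattice (f i)) -> in_lattice (\sum_(i <- r) (m i)%:~R *: f i).
Proof.
move=> f_in; elim: r => [|i r [c cE]].
  by exists (fun=> 0); rewrite big_nil /lattice big1 // => i _; rewrite scale0r.
have [c' c'E] := f_in i.
exists (fun j => m i * c' j + c j); rewrite big_cons cE c'E /lattice scaler_sumr.
by rewrite -big_split; apply: eq_bigr => j _; rewrite /= intrD intrM scalerDl scalerA.
Qed.

Lemma in_lattice_alpha i : in_lattice (alpha i).
Proof.
exists (fun j => (j == i)%:Z); rewrite /lattice (bigD1 i) //= eqxx scale1r.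
by rewrite big1 ?addr0 // => j /negPf ->; rewrite scale0r.
Qed.

Lemma in_lattice_add k x y : in_lattice x -> in_lattice y ->
  in_lattice (x + k%:~R *: y).
Proof.
move=> [c ->] [c' ->]; exists (fun i => c i + k * c' i).
rewrite /lattice scaler_sumr -big_split; apply: eq_bigr => i _ /=.
by rewrite intrD intrM scalerDl scalerA.
Qed.

Definition integral x := forall i, exists z : int, x (hc i) = z%:~R.

Lemma integralD k x y : integral x -> integral y -> integral (x + k%:~R *: y).
Proof.
move=> x_int y_int i; have [z xi] := x_int i; have [z' yi] := y_int i.
by exists (z + k * z'); rewrite labelD labelZ xi yi intrD intrM.
Qed.

Lemma in_lattice_integral x : in_lattice x -> integral x.
Proof.
move=> [m ->] i; exists (\sum_j m j * A i j).
rewrite sum_lfunE (rmorph_sum intr); apply: eq_bigr => j _ /=.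
by rewrite scale_lfunE alphaA intrM.
Qed.

(** After scaling by a square length the function takes integral values, and it
    is bounded below because the form is positive definite. *)
Lemma lattice_minimum (k : nat) (v : dual h) (P : dual h -> Prop) :
  (0 < k)%N -> integral v -> (exists x, in_lattice x /\ P x) ->
  exists x, [/\ in_lattice x, P x &
    forall y, in_lattice y -> P y -> k%:R * B x x + B v x <= k%:R * B y y + B v y].
Proof.
move=> k0 /choice[c cE] [_ [[m0 ->] Pm0]].
have [i0 Bi0] := long_simple.
have two0 : 2 != 0 :> F by rewrite pnatr_eq0.
have scaled w i : B w (alpha i) * (q i0)%:~R = w (hc i) * (q i)%:~R.
  apply: (mulIf two0); rewrite mulrAC form_alpha -mulrA simple_sq_conn Bi0.
  by rewrite -mulrA [2 * _]mulrC.
(* The form on the root lattice, scaled to be integral. *)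
pose S i j := q i * A i j.
pose f m := k%:Z * (\sum_i \sum_j S i j * m i * m j) + \sum_i (c i * q i) * m i.
have fE m : (k%:R * B (lattice m) (lattice m) + B v (lattice m)) * (q i0)%:~R
            = (f m)%:~R.
  rewrite mulrDl intrD intrM -pmulrn -mulrA; congr (_ * _ + _).
    rewrite (rmorph_sum intr) form_sumr mulr_suml; apply: eq_bigr => i _ /=.
    rewrite (rmorph_sum intr) formZr -mulrA scaled /lattice sum_lfunE.
    rewrite mulr_suml mulr_sumr; apply: eq_bigr => j _ /=.
    by rewrite scale_lfunE alphaA /S !intrM -[_ *: _]/(_ * _); ring.
  rewrite (rmorph_sum intr) form_sumr mulr_suml; apply: eq_bigr => i _ /=.
  rewrite formZr -[LHS]mulrA scaled cE !intrM; ring.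
have q_gt0 := cd_sq CD.
have [||||C C_le] := @quad_bounded n S u _ _ _ _ k (fun i => c i * q i) k0.
- by move=> i j; apply: (cd_sym CD).
- by move=> i j ne_ij; rewrite mulr_ge0_le0 ?(cd_off CD) // ltW.
- exact: (cd_u CD).
- move=> i; under eq_bigr => j _ do rewrite /S -mulrA.
  by rewrite -mulr_sumr mulr_gt0 // (cd_Au CD).
have [|m [Pm min_m]] := @bounded_int_minimum _ (P \o lattice) f C _ (fun m _ => C_le m).
  by exists m0.
exists (lattice m); split=> // [|_ [m' ->] Pm']; first by exists m.
have q0 : 0 < (q i0)%:~R :> F by rewrite ltr0z.
by rewrite -(ler_pM2r q0) !fE ler_int; apply: min_m.
Qed.

(** * Dominant weights and the coroot lattice *)

Variable omega : 'I_n -> dual h.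
Hypothesis fund_omega : is_fundamental_weights hc omega.

Lemma label_omega_sum (k : 'I_n -> F) i : (\sum_j k j *: omega j) (hc i) = k i.
Proof.
rewrite sum_lfunE (bigD1 i) //= scale_lfunE fund_omega eqxx big1 => [|j ne_ji].
  by rewrite addr0 -[_ *: _]/(_ * _) mulr1.
by rewrite scale_lfunE fund_omega (negPf ne_ji) scaler0.
Qed.

(** The fundamental weights are linearly independent, being dual to the coroots, and
    their number is the dimension. *)
Lemma omega_expansion x : x = \sum_i x (hc i) *: omega i.
Proof.
pose b := [tuple omega i | i < n].
have bE (i : 'I_n) : b`_i = omega i by rewrite -tnth_nth tnth_mktuple.
have b_basis : basis_of fullv b.
  rewrite basisEfree subvf size_tuple; apply/and3P; split=> //.
    apply/freeP => k sum0 i; rewrite -(label_omega_sum k i).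
    suff -> : \sum_j k j *: omega j = 0 by rewrite zero_lfunE.
    by rewrite -[RHS]sum0; apply: eq_bigr => j _; rewrite bE.
  by rewrite (size_basis alpha_basis).
have xE : x = \sum_i coord b i x *: omega i.
  rewrite [LHS](coord_basis b_basis (memvf x)).
  by apply: eq_bigr => i _; rewrite bE.
by rewrite [LHS]xE; apply: eq_bigr => i _; rewrite [in RHS]xE label_omega_sum.
Qed.

Definition rho : dual h := \sum_i omega i.

Lemma label_rho i : rho (hc i) = 1.
Proof.
rewrite -[RHS](label_omega_sum (fun=> 1) i) /rho.
by under [in RHS]eq_bigr => j _ do rewrite scale1r.
Qed.

(** The form against a simple root is a positive multiple of the label. *)
Lemma form_dominant x y : (forall i, 0 <= x (hc i)) -> root_ge0 y -> 0 <= B x y.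
Proof.
move=> x_dom /nat_span_familyP[m ->]; rewrite form_sumr; apply: sumr_ge0 => j _.
by rewrite -scaler_nat formZr form_simple mulr_ge0 ?ler0n // divr_ge0 ?ler0n.
Qed.

Lemma integral_word s x : integral x -> integral (word s x).
Proof.
move=> x_int; elim: s => //= i s IH; have [z zE] := IH i.
rewrite /simple_reflection zE -scaleNr -intrN; apply: integralD => //.
exact/in_lattice_integral/in_lattice_alpha.
Qed.

(** In the orbit of an integral weight, the element of largest pairing with rho
    is dominant; it exists because the orbit lies in a translate of the root
    lattice, on which invariance of the norm makes the opposite of that pairing a
    positive definite quadratic function. *)
Lemma dominant_conj x : integral x ->
  exists s, forall i, exists k : nat, word s x (hc i) = k%:R.
Proof.
move=> x_int.
pose v := - rho + 2%:~R *: x.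
have v_int : integral v.
  apply: integralD => // i; exists (-1).
  by rewrite labelN label_rho rmorphN1.
have vE y : B v y = - B rho y + 2 * B x y by rewrite formDl formNl formZl.
pose P y := exists s, word s x = x + y.
have ex0 : exists y, in_lattice y /\ P y.
  exists 0; split; last by exists [::]; rewrite /= addr0.
  by exists (fun=> 0); rewrite /lattice big1 // => i _; rewrite scale0r.
have PE y : P y -> 1%:R * B y y + B v y = - B rho y.
  move=> [s sE]; rewrite mul1r vE; have := form_word s x x.
  rewrite sE !formDl !formDr (formC y x) => H.
  have -> : B y y = - (2 * B x y).
    have := congr1 (fun t => t - B x x - 2 * B x y) H.
    by rewrite subrr sub0r => <-; ring.
  by ring.
have [y [y_in [s sE] min_y]] := lattice_minimum (k := 1) isT v_int ex0.
exists s => i.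
have [z zE] : exists z : int, word s x (hc i) = z%:~R by apply: integral_word.
have [z0|z0] := lerP 0 z; first by exists `|z|%N; rewrite zE -[in LHS](gez0_abs z0).
have Py' : P (y + (- z)%:~R *: alpha i).
  by exists (i :: s); rewrite /= /simple_reflection zE sE intrN scaleNr addrA.
have := min_y _ (in_lattice_add _ y_in (in_lattice_alpha i)) Py'.
rewrite !PE //; last by exists s.
rewrite formDr formZr form_simple label_rho lerN2 gerDl.
have d_gt0 : 0 < 1 / (d i)%:R :> F by rewrite divr_gt0 // ltr0n dcoef_gt0.
by rewrite pmulr_lle0 // lerz0 oppr_le0 leNgt z0.
Qed.

Definition coroot_comb (m : 'I_n -> int) : dual h := \sum_i (m i)%:~R *: coroot i.

Definition in_coroot_lattice x := exists m, x = coroot_comb m.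

Lemma in_coroot_co i : in_coroot_lattice (coroot i).
Proof.
exists (fun j => (j == i)%:Z); rewrite /coroot_comb (bigD1 i) //= eqxx scale1r.
by rewrite big1 ?addr0 // => j /negPf ->; rewrite scale0r.
Qed.

Lemma in_coroot_add k x y : in_coroot_lattice x -> in_coroot_lattice y ->
  in_coroot_lattice (x + k%:~R *: y).
Proof.
move=> [c ->] [c' ->]; exists (fun i => c i + k * c' i).
rewrite /coroot_comb scaler_sumr -big_split; apply: eq_bigr => i _ /=.
by rewrite intrD intrM scalerDl scalerA.
Qed.

Lemma label_co i j : coroot i (hc j) = (A i j)%:~R * (d j)%:R.
Proof.
by rewrite -form_co formC form_co /coroot mulrn_lfunE alphaA mulr_natr.
Qed.

Lemma in_coroot_in_lattice x : in_coroot_lattice x -> in_lattice x.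
Proof.
move=> [m ->]; apply: in_lattice_sum => i.
exists (fun j => (d i * (j == i))%:Z); rewrite /lattice (bigD1 i) //= eqxx muln1.
rewrite big1 ?addr0 -?pmulrn ?scaler_nat // => j /negPf ->.
by rewrite muln0 scale0r.
Qed.

(** A coroot is reflected by subtracting an integral multiple of the simple coroot,
    the integer being an entry of the transposed Cartan matrix. *)
Lemma in_coroot_refl i x : in_coroot_lattice x -> in_coroot_lattice (refl i x).
Proof.
move=> x_in; have [m xE] := x_in.
have -> : refl i x = x + (- \sum_j m j * A j i)%:~R *: coroot i.
  rewrite /simple_reflection intrN scaleNr; congr (_ - _).
  rewrite /coroot -scaler_nat scalerA; congr (_ *: _).
  rewrite xE sum_lfunE (rmorph_sum intr) mulr_suml; apply: eq_bigr => j _ /=.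
  by rewrite scale_lfunE label_co intrM -mulrA.
by apply: in_coroot_add => //; apply: in_coroot_co.
Qed.

Lemma in_coroot_word s x : in_coroot_lattice x -> in_coroot_lattice (word s x).
Proof. by move=> x_in; elim: s => //= i s; apply: in_coroot_refl. Qed.

Lemma form_coroot_simple m i : exists z : int, B (coroot_comb m) (alpha i) = z%:~R.
Proof.
exists (\sum_j m j * A j i); rewrite form_suml (rmorph_sum intr).
apply: eq_bigr => j _ /=.
by rewrite formZl formC form_co alphaA intrM.
Qed.

Lemma form_coroot_integral m x : integral x ->
  exists z : int, B x (coroot_comb m) = z%:~R.
Proof.
move=> /choice[c cE]; exists (\sum_j m j * c j).
rewrite form_sumr (rmorph_sum intr); apply: eq_bigr => j _ /=.
by rewrite formZr form_co cE intrM.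
Qed.

(** Each basis vector has the even square length [2 d_i] and the lattice is
    integral. *)
Lemma coroot_lattice_even m :
  exists z : int, B (coroot_comb m) (coroot_comb m) = 2 * z%:~R.
Proof.
rewrite /coroot_comb; elim: (index_enum _) => [|i r [z zE]].
  by exists 0; rewrite big_nil form0l mulr0.
rewrite big_cons; set x := \sum_(_ <- r) _ in zE *.
have [y yE] : exists y : int, x (hc i) = y%:~R.
  apply: in_lattice_integral; apply: in_lattice_sum => j.
  exact/in_coroot_in_lattice/in_coroot_co.
exists (z + m i * y + m i * m i * (d i)%:Z).
rewrite formDl !formDr zE (formC (_ *: coroot i) x) !formZr !formZl !form_co yE.
rewrite label_co (cd_diag CD) !intrD !intrM -pmulrn; ring.
Qed.

(** * The highest root and the alcove *)

Variables (theta : dual h) (htheta : subvs_of h).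
Hypothesis highest_theta : is_highest_root br alpha theta.
Hypothesis coroot_htheta : is_coroot br theta htheta.

Lemma theta_root : is_root br theta.
Proof. by case: highest_theta. Qed.

Lemma theta_max x : is_root br x -> root_ge0 (theta - x).
Proof. by case: highest_theta => _; apply. Qed.

Lemma theta_dominant i : 0 <= theta (hc i).
Proof.
have /theta_max/(root_ge0_coef i) := root_refl i theta_root.
by rewrite /simple_reflection opprB addrC subrK coefZ coef_alpha eqxx mulr1.
Qed.

(** A dominant long root x satisfies (x, x) <= (theta, x) <= (theta, theta). *)
Lemma theta_long : B theta theta = 2.
Proof.
have [_ _ _ [x0 x0_root Bx0] B_le2] := form_B.
have [s x0E] := root_conj_simple x0_root.
(* A long root can be moved to a dominant one. *)
have x0_int : integral x0.
  case: x0E => i ->; apply: integral_word.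
  exact/in_lattice_integral/in_lattice_alpha.
have [t x_dom] := dominant_conj x0_int.
pose x := word t x0.
have x_root : is_root br x by apply: root_word.
have Bx : B x x = 2 by rewrite form_word.
have x_ge0 i : 0 <= x (hc i) by have [k ->] := x_dom i; rewrite ler0n.
have tx_ge0 := theta_max x_root.
apply/le_anti; rewrite (B_le2 _ theta_root) /=.
have := form_dominant theta_dominant tx_ge0; have := form_dominant x_ge0 tx_ge0.
rewrite !formDr !formNr Bx !subr_ge0 (formC x theta).
exact: le_trans.
Qed.

(** The highest root is long, hence conjugate to a long simple root, which equals its
    own coroot. *)
Lemma theta_simple : exists s i, d i = 1%N /\ theta = word s (alpha i).
Proof.
have [s [i thetaE]] := root_conj_simple theta_root.
exists s, i; split=> //.
by rewrite /dcoef -(form_word s) -thetaE theta_long eqxx.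
Qed.

Lemma theta_coroot : in_coroot_lattice theta.
Proof.
have [s [i [di ->]]] := theta_simple; apply: in_coroot_word.
by have := in_coroot_co i; rewrite /coroot di mulr1n.
Qed.

Lemma root_theta_reflection x : is_root br x -> is_root br (x - B x theta *: theta).
Proof.
move=> x_root; have [s [i [_ thetaE]]] := theta_simple.
have -> : x - B x theta *: theta = word s (refl i (word (rev s) x)).
  rewrite -(reflection_multiple _ _ (oner_neq0 F)) scale1r -reflection_word.
  rewrite wordVK -?thetaE; last exact: alpha_hc.
  by rewrite /reflection theta_long [2 * _]mulrC mulfK // pnatr_eq0.
exact/root_word/root_refl/root_word.
Qed.

(** The reflections defined by the coroot and by the form both permute the
    roots, and their composite is a transvection along theta; as there are
    finitely many roots, it is trivial. *)
Lemma label_theta x : x htheta = B x theta.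
Proof.
pose T y : F := B y theta - y htheta.
have T_lin (k : F) y z : T (k *: y + z) = k * T y + T z.
  rewrite /T form_linear add_lfunE scale_lfunE -[_ *: _]/(_ * _).
  ring.
have theta2 : theta htheta = 2 by case: coroot_htheta.
have T_theta : T theta = 0 by rewrite /T theta_long theta2 subrr.
have T_root y : is_root br y -> is_root br (y + T y *: theta).
  move=> /root_theta_reflection/(reflect_root lie_g coroot_htheta)[+ _].
  have -> : (y - B y theta *: theta) htheta = y htheta - B y theta * 2.
    by rewrite add_lfunE opp_lfunE scale_lfunE theta2.
  have -> // : y - B y theta *: theta - (y htheta - B y theta * 2) *: theta
               = y + T y *: theta.
  rewrite -addrA -opprD -scalerDl -scaleNr; congr (_ + _ *: _).
  by rewrite /T; ring.
have T_simple i : T (alpha i) = 0.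
  apply/eqP; apply: contrapT => /negP Ti.
  have a0 : T (alpha i) *: theta != 0.
    by rewrite scaler_eq0 negb_or Ti; case: theta_root.
  apply: (root_string_finite lie_g a0 (b := alpha i)); elim=> [|k IH].
    by rewrite mulr0n addr0; case: simple_alpha.
  have -> : alpha i + (T (alpha i) *: theta) *+ k.+1
            = (alpha i + (T (alpha i) *: theta) *+ k)
              + T (alpha i + (T (alpha i) *: theta) *+ k) *: theta.
    rewrite -addrA mulrSr; congr (_ + (_ + _ *: _)).
    by rewrite -scaler_nat scalerA addrC T_lin T_theta mulr0 add0r.
  exact: T_root.
suff /eqP : T x = 0 by rewrite subr_eq0 => /eqP.
rewrite [x]coef_expansion; elim: (index_enum _) => [|i r IH].
  by rewrite big_nil /T form0l zero_lfunE subrr.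
by rewrite big_cons T_lin T_simple mulr0 add0r.
Qed.

(** The minimised function is [K (l B(mu, mu) + 2 B(x, mu)) - B(rho, mu)], where
    the first bracket is, up to a constant and a factor [l], the squared norm of
    [x + l mu], and [B(rho, mu)] is the height of [mu].  For [K] large, a gain in
    norm outweighs the changes of height that occur in the comparisons. *)
Lemma dominant_translate x l : (0 < l)%N -> integral x ->
  (forall i, x (hc i) <= 0) ->
  exists m s, let mu := coroot_comb m in
    [/\ forall i, exists k : nat, B mu (alpha i) = k%:R,
        forall i, exists k : nat, word s (x + l%:R *: mu) (hc i) = k%:R
      & word s (x + l%:R *: mu) htheta <= l%:R].
Proof.
move=> l0 x_int x_le0.
have [t tE] := theta_coroot.
pose z := \sum_i t i.
have rho_int : integral rho by move=> i; exists 1; rewrite label_rho.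
have rho_theta : B rho theta = z%:~R.
  rewrite tE form_sumr (rmorph_sum intr); apply: eq_bigr => i _ /=.
  by rewrite formZr form_co label_rho mulr1.
(* Larger than the height of theta, so that the norm prevails over the height. *)
pose K := `|z|%N.+1.
have [v v_int vE] : exists2 v, integral v &
    forall y, B v y = - B rho y + (2 * K)%:R * B x y.
  exists (- rho + (2 * K)%:~R *: x) => [|y]; last by rewrite formDl formNl formZl.
  apply: integralD => // i; exists (-1).
  by rewrite labelN label_rho rmorphN1.
have ex0 : exists y, in_lattice y /\ in_coroot_lattice y.
  have c0 : in_coroot_lattice 0.
    by exists (fun=> 0); rewrite /coroot_comb big1 // => i _; rewrite scale0r.
  by exists 0; split=> //; apply: in_coroot_in_lattice.
have Kl0 : (0 < K * l)%N by rewrite muln_gt0.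
have [mu [_ mu_in min_mu]] := lattice_minimum Kl0 v_int ex0.
have {}min_mu y : in_coroot_lattice y ->
    (K * l)%:R * B mu mu + B v mu <= (K * l)%:R * B y y + B v y.
  by move=> y_in; apply: min_mu => //; apply: in_coroot_in_lattice.
(* Minimality against a translate of mu, with the common terms cancelled. *)
have mu_co y : in_coroot_lattice y -> forall k : int,
    0 <= (K * l)%:R * (2 * k%:~R * B mu y + k%:~R ^+ 2 * B y y) + k%:~R * B v y.
  move=> y_in k; have := min_mu _ (in_coroot_add k mu_in y_in).
  rewrite !formDl !formDr !formZr !formZl (formC y mu) -subr_ge0.
  by congr (0 <= _); ring.
have [m muE] := mu_in.
have mu_simple i : exists k : nat, B mu (alpha i) = k%:R.
  have [k kE] : exists k : int, B mu (alpha i) = k%:~R.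
    by rewrite muE; apply: form_coroot_simple.
  have [k0|k0] := lerP 0 k; first by exists `|k|%N; rewrite kE -[in LHS](gez0_abs k0).
  have := mu_co _ (in_coroot_co i) 1.
  have -> : B mu (coroot i) = (d i)%:R * k%:~R by rewrite /coroot -scaler_nat formZr kE.
  rewrite vE !form_co label_co (cd_diag CD) label_rho.
  have [c cE] := x_int i; have := x_le0 i; rewrite cE lerz0 => c_le0.
  have -> : (K * l)%:R * (2 * 1%:~R * ((d i)%:R * k%:~R) + 1%:~R ^+ 2 * (2%:~R * (d i)%:R))
      + 1%:~R * (- 1 + (2 * K)%:R * c%:~R)
    = (2 * (K%:Z * l%:Z * (d i)%:Z * (k + 1) + K%:Z * c) - 1)%:~R :> F by ring.
  have le0 : K%:Z * l%:Z * (d i)%:Z * (k + 1) <= 0 by rewrite mulr_ge0_le0; lia.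
  have le0' : K%:Z * c <= 0 by rewrite mulr_ge0_le0.
  by rewrite ler0z; lia.
pose y := x + l%:R *: mu.
have y_int : integral y.
  rewrite /y pmulrn; apply: integralD => //.
  exact/in_lattice_integral/in_coroot_in_lattice.
have [s sP] := dominant_conj y_int.
exists m, s; rewrite -muE; split=> //.
have [N NE] : exists N : int, word s y htheta = N%:~R.
  by rewrite label_theta tE; apply: form_coroot_integral; apply: integral_word.
rewrite -/y NE pmulrn ler_int leNgt; apply/negP => lt_lN.
(* A value above l would make mu - b better than mu. *)
pose b := word (rev s) theta.
have b_in : in_coroot_lattice b by apply/in_coroot_word/theta_coroot.
have yb : B y b = N%:~R by rewrite -NE label_theta form_word_adj.
have rho_b : B rho b <= z%:~R.
  rewrite -rho_theta -subr_ge0 -formNr -formDr; apply: form_dominant.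
    by move=> i; rewrite label_rho.
  exact/theta_max/root_word/theta_root.
have := mu_co b b_in (-1).
rewrite vE form_word theta_long.
have -> : (K * l)%:R * (2 * (-1)%:~R * B mu b + (-1)%:~R ^+ 2 * 2)
    + (-1)%:~R * (- B rho b + (2 * K)%:R * B x b)
  = B rho b - (2 * K%:Z * (N - l%:Z))%:~R.
  have := yb; rewrite formDl formZl => ybE.
  have {ybE}-> : B x b = N%:~R - l%:R * B mu b by rewrite -ybE addrK.
  ring.
rewrite subr_ge0 => /le_trans/(_ rho_b); rewrite ler_int.
by rewrite /K; nia.
Qed.

(** The conclusions on [x = w0 lam] in terms of fundamental weights, with the
    integrality of the two summands of the coefficient of [delta]. *)
Lemma translate_to_alcove w0 lam l : is_longest alpha hc w0 ->
  weight_ge0 omega lam -> (0 < l)%N ->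
  exists m s, let mu := coroot_comb m in
    [/\ L_ge0 d omega mu,
        exists z : int, B (w0 lam) mu = z%:~R,
        exists z : int, B mu mu = 2 * z%:~R,
        exists k : 'I_n -> nat,
          word s (w0 lam + l%:R *: mu) = \sum_i omega i *+ k i
      & exists2 z : int, word s (w0 lam + l%:R *: mu) htheta = z%:~R & z <= l%:Z].
Proof.
move=> w0_longest /nat_span_familyP[c lamE] l0.
have lam_label i : lam (hc i) = (c i)%:R.
  rewrite lamE -(label_omega_sum (fun i => (c i)%:R)).
  by under [in RHS]eq_bigr => j _ do rewrite scaler_nat.
have x_int : integral (w0 lam).
  case: w0_longest => -[s w0E] _; rewrite w0E; apply: integral_word => i.
  by exists (c i); rewrite lam_label.
have x_le0 i : w0 lam (hc i) <= 0.
  by apply: longest_antidominant w0_longest _ => j; rewrite lam_label ler0n.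
have [m [s [mu_simple y_dom y_le]]] := dominant_translate l0 x_int x_le0.
set mu := coroot_comb m in mu_simple y_dom y_le.
exists m, s; split.
- have [k kE] := choice mu_simple.
  rewrite /L_ge0 -/mu (omega_expansion mu).
  have -> : \sum_i mu (hc i) *: omega i = \sum_i omega i *+ d i *+ k i.
    apply: eq_bigr => i _.
    by rewrite -form_co /coroot -scaler_nat formZr kE -natrM scaler_nat mulrnA.
  by apply: nat_span_sum => i; exists i.
- exact: form_coroot_integral.
- exact: coroot_lattice_even.
- have [k kE] := choice y_dom; exists k.
  rewrite [LHS]omega_expansion; apply: eq_bigr => i _.
  by rewrite kE scaler_nat.
have [t tE] := theta_coroot.
have [|z zE] := @form_coroot_integral t (word s (w0 lam + l%:R *: mu)).
  apply: integral_word; rewrite pmulrn; apply: integralD => //.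
  by apply/in_lattice_integral/in_coroot_in_lattice; exists m.
exists z; first by rewrite label_theta tE.
by rewrite -(ler_int F) -zE -tE -label_theta.
Qed.

End RootCombinatorics.

(** * Affine weights *)

Section AffineWeights.

Variables (F : numClosedFieldType) (g : vectType F) (h : {vspace g}) (n : nat).
Variables (omega : 'I_n -> dual h) (htheta : subvs_of h).

Lemma aff_weylE w (v : dual h) (a b : F) :
  aff_weyl w ((v, a, b) : aff_dual h) = (w v, a, b).
Proof.
congr (_, _, _); rewrite /= ?scaler0 ?addr0 ?add0r //.
  by rewrite -[_ *: _]/(a * 1) mulr1.
by rewrite -[_ *: _]/(b * 1) mulr1.
Qed.

Lemma translationE (B : dual h -> dual h -> F) mu v (a : F) :
  translation B mu (a *: Lambda0 + aff_emb v) =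
  (v + a *: mu, a, - B v mu - a * (2^-1 * B mu mu)).
Proof.
have -> : a *: Lambda0 + aff_emb v = (v, a, 0) :> aff_dual h.
  congr (_, _, _); rewrite /= ?scaler0 ?addr0 ?add0r //.
  by rewrite -[_ *: _]/(a * 1) mulr1.
congr (_, _, _) => /=.
- by rewrite !scaler0 subr0 addr0 add0r subr0.
- by rewrite !scaler0 subr0 add0r subr0 !addr0 -[_ *: _]/(a * 1) mulr1.
have scale1 (k : F) : k *: (1 : F^o) = k by apply: mulr1.
by rewrite !scale0r !addr0 !add0r !scale1 scalerN.
Qed.

Lemma aff_sum (I : Type) (r : seq I) (f : I -> dual h) (p : I -> F) (k : I -> nat) :
  \sum_(i <- r) (aff_emb (f i) + p i *: Lambda0) *+ k i =
  ((\sum_(i <- r) f i *+ k i, \sum_(i <- r) p i *+ k i, 0) : aff_dual h).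
Proof.
elim: r => [|i r IH]; first by rewrite !big_nil.
rewrite !big_cons IH.
have -> : aff_emb (f i) + p i *: Lambda0 = (f i, p i, 0) :> aff_dual h.
  congr (_, _, _); rewrite /= ?scaler0 ?addr0 ?add0r //.
  by rewrite -[_ *: _]/(p i * 1) mulr1.
have -> : ((f i, p i, 0) : aff_dual h) *+ k i = (f i *+ k i, p i *+ k i, 0).
  elim: (k i) => // m IHm; rewrite !mulrS IHm; congr (_, _, _).
  by rewrite /= addr0.
by congr (_, _, _); rewrite /= addr0.
Qed.

Local Notation S := (fun x => exists (y : aff_dual h) (k : int),
    is_aff_fundamental omega htheta y /\ x = y + k%:~R *: delta).

(** A multiple of delta can be absorbed by any one summand. *)
Lemma aff_weight_shift x (k : int) : x != 0 -> aff_weight_ge0 omega htheta x ->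
  aff_weight_ge0 omega htheta (x + k%:~R *: delta).
Proof.
move=> x0 [[|y s] [sS xE]]; first by rewrite xE big_nil eqxx in x0.
rewrite /aff_weight_ge0 xE big_cons addrAC; apply: nat_spanD.
  apply: nat_span_in; have [z [j [z_fund ->]]] : S y by apply: sS; rewrite inE eqxx.
  exists z, (j + k); split=> //.
  by rewrite -addrA -scalerDl intrD.
by exists s; split=> // z zs; apply: sS; rewrite inE zs orbT.
Qed.

Lemma aff_weight_dominant (k : 'I_n -> nat) (v : dual h) (l : nat) (z j : int) :
  (0 < l)%N -> v = \sum_i omega i *+ k i -> v htheta = z%:~R -> z <= l%:Z ->
  aff_weight_ge0 omega htheta ((v, l%:R, j%:~R) : aff_dual h).
Proof.
move=> l0 vE vtheta z_le.
have -> : ((v, l%:R, j%:~R) : aff_dual h) = (v, l%:R, 0) + j%:~R *: delta.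
  congr (_, _, _); rewrite /= ?scaler0 ?addr0 ?add0r //.
  by rewrite -[_ *: _]/(_ * 1) mulr1.
apply: aff_weight_shift.
  by apply/eqP => -[_ /eqP]; rewrite pnatr_eq0 => /eqP l_eq0; rewrite l_eq0 in l0.
(* The multiplicity of Lambda_0. *)
have [r rE] : exists r : nat, l%:Z = z + r%:Z by exists `|l%:Z - z|%N; lia.
have -> : ((v, l%:R, 0) : aff_dual h) =
    \sum_i (aff_emb (omega i) + (omega i htheta : F) *: Lambda0) *+ k i
    + Lambda0 *+ r.
  have -> : (Lambda0 *+ r : aff_dual h) = (0, r%:R, 0).
    elim: r {rE} => // r IH; rewrite mulrS IH; congr (_, _, _); rewrite /= ?addr0 //.
    exact/esym/mulrS.
  rewrite aff_sum -vE; congr (_, _, _); rewrite /= ?addr0 //.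
  have -> : \sum_i (omega i htheta : F) *+ k i = v htheta.
    rewrite vE sum_lfunE; apply: eq_bigr => i _.
    by rewrite mulrn_lfunE.
  by rewrite vtheta pmulrn rE intrD.
have S_fund y : is_aff_fundamental omega htheta y -> S y.
  by move=> y_fund; exists y, 0; rewrite scale0r addr0.
apply: nat_spanD.
  by apply: nat_span_sum => i; apply: S_fund; right; exists i.
by apply: nat_span_muln; apply: S_fund; left.
Qed.

End AffineWeights.

Local Open Scope complex_scope.

Theorem mainTheorem2 (R : realType) (g : vectType R[i]) (br : g -> g -> g)
    (h : {vspace g}) (n : nat)
    (alpha : 'I_n -> dual h) (hc : 'I_n -> subvs_of h)
    (omega : 'I_n -> dual h) (theta : dual h) (htheta : subvs_of h)
    (w0 : dual h -> dual h) (B : dual h -> dual h -> R[i])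
    (X : lie_type)
    (lie_g : is_lie_bracket br)
    (simple_g : is_simple br)
    (cartan_h : is_cartan br h)
    (simple_alpha : is_simple_roots br alpha)
    (coroot_hc : forall i, is_coroot br (alpha i) (hc i))
    (fund_omega : is_fundamental_weights hc omega)
    (highest_theta : is_highest_root br alpha theta)
    (coroot_htheta : is_coroot br theta htheta)
    (longest_w0 : is_longest alpha hc w0)
    (form_B : is_normalized_form br alpha hc B)
    (type_X : has_type X alpha hc)
    (lam : dual h) (l : nat)
    (lam_dom : weight_ge0 omega lam)
    (l_gt0 : (0 < l)%N)
    (lam_le : forall i, lam (hc i) <= (dcoef X B alpha i * l)%:R) :
  exists (mu : dual h) (w : dual h -> dual h),
    [/\ L_ge0 (dcoef X B alpha) omega mu,
        in_weyl alpha hc w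
      & aff_weight_ge0 omega htheta
          (aff_weyl w (translation B mu
             (l%:R *: Lambda0 + aff_emb (w0 lam))))].
Proof.
have [A [q [u [CD alphaA]]]] := type_cartan_datum type_X.
have [m [s [mu_L [z1 Bx] [z2 Bmu] [k yE] [z y_theta z_le]]]] :=
  translate_to_alcove lie_g cartan_h simple_alpha coroot_hc alphaA CD form_B
    fund_omega highest_theta coroot_htheta longest_w0 lam_dom l_gt0.
set mu := coroot_comb _ _ _ _ in mu_L Bx Bmu yE y_theta.
exists mu, (weyl_word alpha hc s); split=> //; first exact: in_weyl_word.
have int_delta : - B (w0 lam) mu - l%:R * (2^-1 * B mu mu) = (- z1 - l%:Z * z2)%:~R.
  by rewrite Bx Bmu mulKf ?pnatr_eq0 // intrB intrN intrM.
rewrite translationE int_delta aff_weylE.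
exact: aff_weight_dominant l_gt0 yE y_theta z_le.
Qed.
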